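(* Let $\lambda>0$, let $\pi\in\mathcal M$, let $\mathcal P$ be a set of probability distributions on $\mathcal Z$, and let $\delta_\lambda:\mathcal Z\times\mathcal G\times\bar{\mathcal G}\to\mathbb R$ be a function satisfying the variance inequality (with associated map $\rho\mapsto\hat\pi(\rho)$). Let $P\in\mathcal P$, let $Z_1,\dots,Z_n$ be i.i.d. with law $P$, and put $\Delta_\lambda(g,g')=\mathbb E_{Z\sim P}\,\delta_\lambda(Z,g,g')$ for $g\in\mathcal G$, $g'\in\bar{\mathcal G}$. Let $\hat\mu$ be the randomizing distribution of the SeqRand algorithm. Then $$\mathbb E_{Z_1^n}\mathbb E_{g'\sim\hat\mu}R(g')\le\min_{\rho\in\mathcal M}\Big\{\mathbb E_{g\sim\rho}R(g)+\mathbb E_{g\sim\rho}\mathbb E_{Z_1^n}\mathbb E_{g'\sim\hat\mu}\Delta_\lambda(g,g')+\frac{K(\rho,\pi)}{\lambda(n+1)}\Big\}.$$ In particular, when $\mathcal G$ is finite and the loss function $L$ and the set $\mathcal P$ are such that one can take $\delta_\lambda\equiv0$, by taking $\pi$ uniform on $\mathcal G$ we get $$\mathbb E_{Z_1^n}\mathbb E_{g\sim\hat\mu}R(g)\le\min_{g\in\mathcal G}R(g)+\frac{\log|\mathcal G|}{\lambda(n+1)}.$$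
   Context: Setting: $\mathcal Z=\mathcal X\times\mathcal Y$ is the data space; a prediction function is a measurable map $\mathcal X\to\mathcal Y$; $\bar{\mathcal G}$ is the set of all prediction functions (equipped with a $\sigma$-algebra) and $\mathcal D$ the set of probability distributions on $\bar{\mathcal G}$; $\mathcal G\subset\bar{\mathcal G}$ is the reference set (a measurable space) and $\mathcal M$ the set of probability distributions on $\mathcal G$. $L(z,g)\in\mathbb R$ is the loss of the prediction function $g$ on the data point $z\in\mathcal Z$, and $R(g)=\mathbb E_{Z\sim P}L(Z,g)$ is the risk. All quantities manipulated are implicitly assumed to be measurable and the expectations to be well defined. $Z_1^n=(Z_1,\dots,Z_n)$. $K(\rho,\pi)$ is the Kullback-Leibler divergence: $\mathbb E_{g\sim\rho}\log\frac{d\rho}{d\pi}(g)$ if $\rho\ll\pi$ and $+\infty$ otherwise. For measurable $h:\mathcal G\to\mathbb R$, the Gibbs distribution is $\pi_{-h}(dg)=\frac{e^{-h(g)}}{\mathbb E_{g'\sim\pi}e^{-h(g')}}\pi(dg)$. Variance inequality: for every $\rho\in\mathcal M$ there exists $\hat\pi(\rho)\in\mathcal D$ such that $$\sup_{P\in\mathcal P}\Big\{\mathbb E_{Z\sim P}\mathbb E_{g'\sim\hat\pi(\rho)}\log\mathbb E_{g\sim\rho}e^{\lambda[L(Z,g')-L(Z,g)-\delta_\lambda(Z,g,g')]}\Big\}\le0.$$ SeqRand algorithm: set $S_0\equiv0$ and draw $\hat g_0$ from $\hat\rho_0=\hat\pi(\pi)$. For $i=1,\dots,n$ define $S_i(g)=S_{i-1}(g)+L(Z_i,g)+\delta_\lambda(Z_i,g,\hat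 g_{i-1})$ for $g\in\mathcal G$, let $\hat\rho_i=\hat\pi(\pi_{-\lambda S_i})$ and draw $\hat g_i$ from $\hat\rho_i$. Output a function drawn uniformly from $\{\hat g_0,\dots,\hat g_n\}$. Conditionally on $Z_1^n$, the distribution of the output function is denoted $\hat\mu$; thus $\mathbb E_{g\sim\hat\mu}h(g)=\mathbb E\big[\frac1{n+1}\sum_{i=0}^nh(\hat g_i)\,\big|\,Z_1^n\big]$. *)

(* Defs.v *)
From HB Require Import structures.
From mathcomp Require Import all_boot all_order all_algebra.
From mathcomp Require Import finmap.
From mathcomp Require Import all_classical all_reals all_analysis.
From mathcomp Require Import measurable_realfun.

Set Implicit Arguments.
Unset Strict Implicit.
Unset Printing Implicit Defensive.

Import Order.TTheory GRing.Theory Num.Theory.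

Local Open Scope classical_set_scope.
Local Open Scope ring_scope.
Local Open Scope ereal_scope.

(** * Integrals, divergence and Gibbs distributions *)

(** [\int[mu]_x f x] is total in the library; it is a meaningful element of
    [[-oo, +oo]] exactly when [f] is measurable and its positive and negative
    parts are not both of infinite integral. *)
Definition well_defined_integral {d} {T : measurableType d} {R : realType}
    (mu : {measure set T -> \bar R}) (f : T -> \bar R) : Prop :=
  measurable_fun [set: T] f /\
  (\int[mu]_x (f^\+ x) < +oo \/ \int[mu]_x (f^\- x) < +oo).

Definition KL {d} {T : measurableType d} {R : realType}
    (rho pi : probability T R) : \bar R :=
  if `[< rho `<< pi >] then
    \int[rho]_x lne (Radon_Nikodym (charge_of_finite_measure rho) pi x)
  else +oo.

Section gibbs.
Context {d} {T : measurableType d} {R : realType}.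
Variables (pi : probability T R) (h : T -> R).

(** The measure [A |-> E_pi [1_A e^(-h)]]; the case distinction makes it a
    measure for every [h]. *)
Definition gibbs_weight (A : set T) : \bar R :=
  if `[< measurable_fun [set: T] h >] then
    \int[pi]_(x in A) (expR (- h x))%:E
  else 0.

Let gibbs_weight0 : gibbs_weight set0 = 0.
Proof. by rewrite /gibbs_weight; case: ifP => // _; rewrite integral_set0. Qed.

Let gibbs_weight_ge0 A : 0 <= gibbs_weight A.
Proof.
rewrite /gibbs_weight; case: ifP => // _; apply: integral_ge0 => x _.
by rewrite lee_fin expR_ge0.
Qed.

Let gibbs_weight_sigma_additive : semi_sigma_additive gibbs_weight.
Proof.
rewrite /gibbs_weight; case: asboolP => [mh|_] F mF tF mUF /=; last first.
  rewrite [X in X @ _ --> _](_ : _ = cst 0); first exact: cvg_cst.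
  by apply/funext => n; rewrite big1.
apply: semi_sigma_additive_nng_induced => //.
  apply/measurable_EFinP; apply: measurableT_comp; first exact: measurable_expR.
  exact: measurable_funN.
Qed.

HB.instance Definition _ := isMeasure.Build _ _ _ gibbs_weight
  gibbs_weight0 gibbs_weight_ge0 gibbs_weight_sigma_additive.

(** [pi_{-h}].  When [h] is not measurable or [E_pi e^(-h) = +oo] the Gibbs
    distribution does not exist and [mnormalize] returns [pi]. *)
Definition gibbs : probability T R := mnormalize gibbs_weight pi.

End gibbs.

(** * Independence and conditional distributions *)

(** [Z 0, .., Z (n-1)] are i.i.d. with law [P]; taking some [A k] to be the
    whole space gives the product rule for every subfamily. *)
Definition iid {dO d} {Omega : measurableType dO} {T : measurableType d}
    {R : realType} (Pr : probability Omega R) (P : probability T R) (n : nat)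
    (Z : nat -> Omega -> T) : Prop :=
  [/\ forall k, (k < n)%N -> measurable_fun [set: Omega] (Z k),
      forall k A, (k < n)%N -> measurable A -> Pr (Z k @^-1` A) = P A
    & forall A : nat -> set T, (forall k, measurable (A k)) ->
        Pr (\bigcap_(k in `I_n) (Z k @^-1` A k)) =
        \prod_(k < n) Pr (Z k @^-1` A k)].

(** [kappa] is a regular conditional distribution of [X] given [H]. *)
Definition conditional_law {dO d1 d2} {Omega : measurableType dO}
    {T1 : measurableType d1} {T2 : measurableType d2} {R : realType}
    (Pr : probability Omega R) (H : Omega -> T1) (X : Omega -> T2)
    (kappa : T1 -> probability T2 R) : Prop :=
  [/\ measurable_fun [set: Omega] H,
      measurable_fun [set: Omega] X,
      forall B, measurable B -> measurable_fun [set: T1] (fun h => kappa h B)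
    & forall A B, measurable A -> measurable B ->
        Pr (H @^-1` A `&` X @^-1` B) =
        \int[Pr]_(w in H @^-1` A) kappa (H w) B].

(** [J] is uniform on [{0, .., n}] and independent of [H]. *)
Definition uniform_index_indep {dO d} {Omega : measurableType dO}
    {T : measurableType d} {R : realType} (Pr : probability Omega R) (n : nat)
    (H : Omega -> T) (J : Omega -> 'I_n.+1) : Prop :=
  forall j, measurable (J @^-1` [set j]) /\
    forall A, measurable A ->
      Pr (H @^-1` A `&` J @^-1` [set j]) = (n.+1%:R^-1)%:E * Pr (H @^-1` A).

Definition uniform_distribution {d} {T : measurableType d} {R : realType}
    (pi : probability T R) : Prop :=
  finite_set [set: T] /\
  forall A : set T, measurable A ->
    pi A = ((#|` fset_set A|)%:R / (#|` fset_set [set: T]|)%:R)%:E.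

(** * Prediction functions *)

Section mfun_pointed.
Context {dX dY} {X : measurableType dX} {Y : measurableType dY}.
HB.instance Definition _ :=
  isPointed.Build {mfun X >-> Y} [the {mfun X >-> Y} of cst point].
End mfun_pointed.

(** The set of all prediction functions, with the sigma-algebra generated by
    [F]; every sigma-algebra on it is of this form. *)
Notation predictor F := (g_sigma_algebraType F) (only parsing).

(** * The sequential randomized algorithm

    [Zt] is the data space, [Gb] the space of all prediction functions, [G] the
    reference set and [incl] its inclusion in [Gb]. *)

Section seqrand.
Context {dZ dB dG} {Zt : measurableType dZ} {Gb : measurableType dB}
  {G : measurableType dG} {R : realType}.
Variables (incl : G -> Gb) (L : Zt -> Gb -> R) (delta : Zt -> G -> Gb -> R).

Definition risk (P : probability Zt R) (g : Gb) : \bar R :=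
  \int[P]_z (L z g)%:E.

Definition Delta (P : probability Zt R) (g : G) (g' : Gb) : \bar R :=
  \int[P]_z (delta z g g')%:E.

Definition log_mgf (lambda : R) (rho : probability G R) (z : Zt) (g' : Gb)
    : \bar R :=
  lne (\int[rho]_g
    (expR (lambda * (L z g' - L z (incl g) - delta z g g')))%:E).

Definition variance_inequality (lambda : R) (PP : set (probability Zt R))
    (pihat : probability G R -> probability Gb R) : Prop :=
  forall rho : probability G R,
    (forall P, PP P ->
      well_defined_integral (P \x pihat rho)
        (fun x => log_mgf lambda rho x.1 x.2)) /\
    ereal_sup [set \int[P]_z \int[pihat rho]_g' log_mgf lambda rho z g'
              | P in PP] <= 0.

(** [S_i] as a function of the history [(Z_1, g_0); ..; (Z_i, g_(i-1))]. *)
Definition cumulative_loss (h : seq (Zt * Gb)) : G -> R :=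
  foldl (fun S p g => S g + L p.1 (incl g) + delta p.1 g p.2)%R (fun=> 0%R) h.

Context {dO} {Omega : measurableType dO}.
Variables (n : nat) (Z : nat -> Omega -> Zt) (ghat : nat -> Omega -> Gb).

(** The random variables are indexed from [0]: [Z k] stands for [Z_(k+1)]. *)
Definition sample (w : Omega) : n.-tuple Zt := [tuple Z k w | k < n].

Definition history (i : nat) (w : Omega) : n.-tuple Zt * i.-tuple Gb :=
  (sample w, [tuple ghat k w | k < i]).

(** The law [rhohat_i] from which [ghat i] is drawn.  For [i <= n], [zip] keeps
    the first [i] data points, so only [Z_1, .., Z_i] are used. *)
Definition rhohat (lambda : R) (pi : probability G R)
    (pihat : probability G R -> probability Gb R) (i : nat)
    (h : n.-tuple Zt * i.-tuple Gb) : probability Gb R :=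
  pihat (gibbs pi (fun g => lambda * cumulative_loss (zip h.1 h.2) g)%R).

Definition output (J : Omega -> 'I_n.+1) (w : Omega) : Gb := ghat (J w) w.

(** A run of SeqRand on the probability space [(Omega, Pr)]: [ghat i] is drawn
    from [rhohat_i] given the whole sample and the previous draws, the output is
    [ghat J] with [J] drawn uniformly, and [muhat] is the conditional
    distribution of the output given the sample. *)
Record SeqRand (lambda : R) (pi : probability G R)
    (pihat : probability G R -> probability Gb R) (Pr : probability Omega R)
    (J : Omega -> 'I_n.+1) (muhat : n.-tuple Zt -> probability Gb R) : Prop :=
  { SeqRand_draw : forall i, (i <= n)%N ->
      conditional_law Pr (history i) (ghat i) (rhohat lambda pi pihat (i := i));
    SeqRand_index : uniform_index_indep Pr (history n.+1) J;
    SeqRand_muhat : conditional_law Pr sample (output J) muhat }.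

Variables (Pr : probability Omega R) (P : probability Zt R)
  (muhat : n.-tuple Zt -> probability Gb R).

Definition expected_risk : \bar R :=
  \int[Pr]_w \int[muhat (sample w)]_g' risk P g'.

(** Well-definedness with respect to the joint law of a fresh data point and the
    output of the algorithm. *)
Definition expected_risk_defined (J : Omega -> 'I_n.+1) : Prop :=
  well_defined_integral (Pr \x P) (fun x => (L x.2 (output J x.1))%:E).

Definition expected_Delta (rho : probability G R) : \bar R :=
  \int[rho]_g \int[Pr]_w \int[muhat (sample w)]_g' Delta P g g'.

Definition oracle_bound (lambda : R) (pi rho : probability G R) : \bar R :=
  (\int[rho]_g risk P (incl g)) + expected_Delta rho
  + KL rho pi * ((lambda * n.+1%:R)^-1)%:E.

(** The expectations in [oracle_bound] are well defined, and their sum is not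
    of the form [+oo - oo]. *)
Definition oracle_bound_defined (lambda : R) (J : Omega -> 'I_n.+1)
    (pi rho : probability G R) : Prop :=
  [/\ well_defined_integral (P \x rho) (fun x => (L x.1 (incl x.2))%:E),
      well_defined_integral ((Pr \x P) \x rho)
        (fun x => (delta x.1.2 x.2 (output J x.1.1))%:E),
      (\int[rho]_g risk P (incl g)) +? expected_Delta rho
    & ((\int[rho]_g risk P (incl g)) + expected_Delta rho)
        +? (KL rho pi * ((lambda * n.+1%:R)^-1)%:E)].

End seqrand.

(* Main.v *)
(** Along a run of SeqRand put [S_i = cumulative_loss] and consider the potential
    [N_i = lambda * \sum_(k < i) L (Z k) (ghat k) + ln E_pi exp (- lambda * S_i)].
    Its increment from [i] to [i + 1] is [log_mgf] of the Gibbs distribution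
    [pi_{- lambda S_i}] at the point [(Z i, ghat i)], so that the variance
    inequality makes [N] a supermartingale started at [N_0 = 0]; hence
    [E N_(n+1) <= 0], once a fresh data point is added to the sample.
    Donsker-Varadhan bounds [ln E_pi exp (- lambda * S_(n+1))] below by
    [- lambda * E_rho S_(n+1) - K(rho, pi)].  Since [ghat i] depends only on the
    data points of index less than [i], [Z i] can be replaced in each summand by
    the fresh point, and averaging over [i <= n] turns the sums into expectations
    under [muhat].  For finite [G] one takes Dirac masses for [rho].

    Nothing ensures that the increments are integrable, nor that the Gibbs
    distributions exist.  The first difficulty is handled by comparing integrals
    of positive and negative parts, the second by the convention [N = +oo] when
    [E_pi exp (- lambda * S) = +oo]. *)

Require Import Defs.
From HB Require Import structures.
From mathcomp Require Import all_boot all_order all_algebra.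
From mathcomp Require Import finmap.
From mathcomp Require Import all_classical all_reals all_analysis.
From mathcomp Require Import measurable_realfun.
From mathcomp Require Import zify ring lra.

Set Implicit Arguments.
Unset Strict Implicit.
Unset Printing Implicit Defensive.

Import Order.TTheory GRing.Theory Num.Theory.

Local Open Scope classical_set_scope.
Local Open Scope ring_scope.
Local Open Scope ereal_scope.

(** * Integrals of functions that need not be integrable *)

(** Three points shape the proof. There are [n + 1] draws but [n] data points, so the last draw has
    nothing to be tested on; the fresh point supplies the missing pair, and this extra step is what
    yields the factor [n + 1]. Next, finiteness cannot be propagated forward from the start: the
    variance inequality allows increments whose negative part has infinite integral. Once the
    trivial cases are set aside, the well-definedness hypotheses make the negative part of the final
    potential integrable; this is carried backward to every earlier stage, and only then are
    positive parts bounded going forward. Last, Donsker-Varadhan is not applied to each history and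
    then integrated: the gap in it is the integral of the logarithm of a ratio of densities, treated
    as one function [x] on the product space with [e^x] of integral at most 1. By [1 + x <= e^x] its
    positive part has finite integral and its integral is nonpositive, so the argument stays among
    functions with positive part of finite integral, on which integration is additive. *)

(** Written without subtraction, the identity survives [+oo - oo]: it keeps track
    of the two parts of a sum even when [a + b] is a junk value. *)
Lemma posneg_addE (R : realType) (a b : \bar R) :
  maxe (a + b) 0 + (maxe (- a) 0 + maxe (- b) 0) =
  maxe (- (a + b)) 0 + (maxe a 0 + maxe b 0).
Proof.
have posy x : 0 <= maxe x (0 : \bar R) by rewrite le_max lexx orbT.
have posNy x : 0 <= x -> x != -oo :> \bar R by case: x.
have ypos x : +oo + maxe x (0 : \bar R) = +oo.
  by rewrite addye// posNy.
have posyr x : maxe x (0 : \bar R) + +oo = +oo by rewrite addeC ypos.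
have maxy : maxe +oo (0 : \bar R) = +oo by rewrite max_l// leey.
have maxNy : maxe -oo (0 : \bar R) = 0 by rewrite max_r// leNye.
case: a => [a| |]; case: b => [b| |] //=;
  rewrite ?maxy ?maxNy ?ypos ?posyr ?adde0 ?add0e ?ypos ?posyr //.
rewrite -?EFinD -!EFin_max -!EFinD; congr (_%:E).
have h (x : R) : Num.max x 0%R = (x + Num.max (- x) 0%R)%R.
  by case: (leP x 0%R) => x0; case: leP => y0; lra.
by rewrite (h (a + b)%R) (h a) (h b); ring.
Qed.

Section posneg_integral.
Context {d} {T : measurableType d} {R : realType}.
Implicit Types (mu : {measure set T -> \bar R}) (f g a b : T -> \bar R).

Lemma integral_funepos_ge0 mu f : 0 <= \int[mu]_x f^\+ x.
Proof. exact: integral_ge0. Qed.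

Lemma integral_funeneg_ge0 mu f : 0 <= \int[mu]_x f^\- x.
Proof. exact: integral_ge0. Qed.

Lemma integral_posneg_addE mu f g :
  measurable_fun setT f -> measurable_fun setT g ->
  \int[mu]_x (f \+ g)^\+ x + (\int[mu]_x f^\- x + \int[mu]_x g^\- x) =
  \int[mu]_x (f \+ g)^\- x + (\int[mu]_x f^\+ x + \int[mu]_x g^\+ x).
Proof.
move=> mf mg; have mfg : measurable_fun setT (f \+ g) by exact: emeasurable_funD.
have sumE (u v w : T -> \bar R) : measurable_fun setT u ->
    measurable_fun setT v -> measurable_fun setT w ->
    (forall x, 0 <= u x) -> (forall x, 0 <= v x) -> (forall x, 0 <= w x) ->
    \int[mu]_x u x + (\int[mu]_x v x + \int[mu]_x w x) =
    \int[mu]_x (u x + (v x + w x)).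
  move=> mu_ mv mw u0 v0 w0; rewrite ge0_integralD ?ge0_integralD//.
  - by move=> x _; exact: adde_ge0.
  - exact: emeasurable_funD.
rewrite !sumE//; try by [apply: measurable_funepos | apply: measurable_funeneg].
by apply: eq_integral => x _; rewrite !funeposE !funenegE; exact: posneg_addE.
Qed.

Lemma integral_funeposD_le mu f g :
  measurable_fun setT f -> measurable_fun setT g ->
  \int[mu]_x (f \+ g)^\+ x <= \int[mu]_x f^\+ x + \int[mu]_x g^\+ x.
Proof.
move=> mf mg; rewrite -ge0_integralD//; try by apply: measurable_funepos.
apply: ge0_le_integral => //.
- by apply: measurable_funepos; exact: emeasurable_funD.
- by apply: emeasurable_funD; exact: measurable_funepos.
- move=> x _; rewrite funeposE ge_max; apply/andP; split; last exact: adde_ge0.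
  by rewrite !funeposE leeD// le_max lexx.
Qed.

(** With both positive parts of finite integral no [+oo - oo] can occur, and the identity between
    parts can be solved for the integral of the sum. Integrals equal to [-oo] remain allowed, unlike
    in additivity for integrable functions. *)
Lemma integral_upperD mu f g :
  measurable_fun setT f -> measurable_fun setT g ->
  \int[mu]_x f^\+ x < +oo -> \int[mu]_x g^\+ x < +oo ->
  \int[mu]_x (f x + g x) = \int[mu]_x f x + \int[mu]_x g x.
Proof.
move=> mf mg fy gy; have := integral_posneg_addE mu mf mg.
have := integral_funeposD_le mu mf mg.
rewrite (integralE _ _ f) (integralE _ _ g) (integralE _ _ (f \+ g)).
move: (integral_funepos_ge0 mu f).
move: (integral_funepos_ge0 mu g).
move: (integral_funepos_ge0 mu (f \+ g)).
move: (integral_funeneg_ge0 mu f).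
move: (integral_funeneg_ge0 mu g).
move: (integral_funeneg_ge0 mu (f \+ g)).
move: (\int[mu]_x f^\+ x) (\int[mu]_x g^\+ x) (\int[mu]_x (f \+ g)^\+ x) fy gy.
move: (\int[mu]_x f^\- x) (\int[mu]_x g^\- x) (\int[mu]_x (f \+ g)^\- x).
move=> [fn| |] [gn| |] [sn| |] // [fp| |] [gp| |] [sp| |] //= _ _ _ _ _ _ _ _ _.
by rewrite -?EFinN -!EFinD => -[h]; congr (_%:E); lra.
Qed.

(** Here [a] and [b] may overlap, so they need not be the parts of [f]. The equality is asked almost
    everywhere only, since in iterated integrals [a x] and [b x] can both be [+oo] at some
    points. *)
Lemma integral_diff mu f a b :
  measurable_fun setT f -> measurable_fun setT a -> measurable_fun setT b ->
  (forall x, 0 <= a x) -> (forall x, 0 <= b x) ->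
  {ae mu, forall x, f x = a x - b x} ->
  \int[mu]_x a x < +oo \/ \int[mu]_x b x < +oo ->
  \int[mu]_x f x = \int[mu]_x a x - \int[mu]_x b x.
Proof.
move=> mf ma mb a0 b0 fab aby.
have mab : measurable_fun setT (fun x => a x - b x) by exact: emeasurable_funB.
rewrite (ae_eq_integral (fun x => a x - b x) _ measurableT mf mab); last first.
  by apply: filterS fab => x /= ->.
have ap : a^\+ = a by apply/funext => x; rewrite funeposE max_l.
have bp : b^\+ = b by apply/funext => x; rewrite funeposE max_l.
have an : a^\- = cst 0 by apply/funext => x; rewrite funenegE max_r// oppe_le0.
have bn : b^\- = cst 0 by apply/funext => x; rewrite funenegE max_r// oppe_le0.
have Nbp : (\- b)^\+ = cst 0 by rewrite funeposN.
have mNb : measurable_fun setT (\- b) by exact: measurableT_comp.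
have Nb : \int[mu]_x (\- b) x = - \int[mu]_x b x by rewrite integral_ge0N.
case: aby => [ay|b_y].
  rewrite (@integral_upperD mu a (\- b))//; last by rewrite Nbp integral0.
    by rewrite Nb.
  by rewrite ap.
have [ay|] := ltP (\int[mu]_x a x) +oo.
  rewrite (@integral_upperD mu a (\- b))//; last by rewrite Nbp integral0.
    by rewrite Nb.
  by rewrite ap.
(* Only [a] has infinite integral: the negative part of [a - b] is at most [b], so the identity
   between parts forces the positive part to have infinite integral. *)
rewrite leye_eq => /eqP ay.
rewrite (integralE _ _ (fun x => a x - b x)).
have := integral_posneg_addE mu ma mNb.
rewrite Nbp funenegN ap an bp ay integral0.
have : \int[mu]_x (a \- b)^\- x <= \int[mu]_x b x.
  apply: ge0_le_integral => //.
  - exact: measurable_funeneg.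
  - move=> x _; rewrite funenegE ge_max b0 andbT.
    move: (a x) (b x) (a0 x) (b0 x) => [u| |] [v| |]//=; rewrite ?leNye//.
    by rewrite -?EFinN -?EFinD -?EFinN !lee_fin; lra.
move: b_y (integral_ge0 mu (fun x (_ : setT x) => b0 x)).
move: (integral_funeneg_ge0 mu (a \- b)).
move: (integral_funepos_ge0 mu (a \- b)).
move: (\int[mu]_x (a \- b)^\- x) (\int[mu]_x (a \- b)^\+ x) (\int[mu]_x b x).
by move=> [p| |] [q| |] [r| |].
Qed.

Lemma integral_posneg_le0 mu f : \int[mu]_x f^\+ x < +oo ->
  \int[mu]_x f^\+ x <= \int[mu]_x f^\- x -> \int[mu]_x f x <= 0.
Proof.
rewrite (integralE _ _ f); move: (integral_funepos_ge0 mu f).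
move: (integral_funeneg_ge0 mu f).
move: (\int[mu]_x f^\+ x) (\int[mu]_x f^\- x) => [a| |] [b| |]//= _ _ _.
by rewrite -EFinD !lee_fin subr_le0.
Qed.

End posneg_integral.

Lemma integral_probability_cst {d} {T : measurableType d} {R : realType}
    (mu : probability T R) (c : \bar R) : \int[mu]_x c = c.
Proof.
transitivity (c * mu setT); first exact: integral_cst.
by rewrite probability_setT mule1.
Qed.

(** A zero integral would make [f] vanish almost everywhere, hence make the whole space null,
    against total mass 1. *)
Lemma integral_gt0 {d} {T : measurableType d} {R : realType}
    (mu : probability T R) (f : T -> \bar R) :
  measurable_fun setT f -> (forall x, 0 < f x) -> 0 < \int[mu]_x f x.
Proof.
move=> mf f0; rewrite lt0e integral_ge0 ?andbT; last by move=> x _; exact: ltW.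
apply/eqP => If0; have := probability_setT mu.
have : ae_eq mu setT f (cst 0).
  apply/(ae_eq_integral_abs mu measurableT mf).
  by rewrite -If0; apply: eq_integral => x _; rewrite gee0_abs// ltW.
move=> [N [mN N0 fN]].
suff -> : [set: T] = N by rewrite N0 => /esym/eqP; rewrite onee_eq0.
apply/esym/seteqP; split => // x _; apply: fN => /= /(_ I) fx0.
by have := f0 x; rewrite fx0 ltxx.
Qed.

Lemma integral_compE {d} {S : Type} {T : measurableType d} {R : realType}
    (m : {measure set T -> \bar R}) (f : S -> \bar R) (u : T -> S) :
  \int[m]_y f (u y) = \int[m]_y f^\+ (u y) - \int[m]_y f^\- (u y).
Proof.
rewrite integralE; congr (_ - _); apply: eq_integral => y _.
  by rewrite !funeposE.
by rewrite !funenegE.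
Qed.

(** * Fubini's theorem when only one part has finite integral *)

Section fubini_semi.
Context {d1 d2} {T1 : measurableType d1} {T2 : measurableType d2} {R : realType}.
Variables (m1 : {sigma_finite_measure set T1 -> \bar R})
  (m2 : {sigma_finite_measure set T2 -> \bar R}) (f : T1 * T2 -> \bar R).
Hypotheses (mf : measurable_fun setT f)
  (semi : \int[m1 \x m2]_x f^\+ x < +oo \/ \int[m1 \x m2]_x f^\- x < +oo).

Let mfp : measurable_fun setT f^\+. Proof. exact: measurable_funepos. Qed.
Let mfn : measurable_fun setT f^\-. Proof. exact: measurable_funeneg. Qed.

(** Tonelli applies to [f^\+] and [f^\-] separately. The inner integral is by definition the
    difference of those of the parts, and [integral_diff] carries this difference through the outer
    one. *)
Lemma fubini_semi1 : \int[m1]_x \int[m2]_y f (x, y) = \int[m1 \x m2]_z f z.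
Proof.
have mF := measurable_fun_fubini_tonelli_F f^\+ mfp (fun=> funepos_ge0 _ _).
have mF' := measurable_fun_fubini_tonelli_F f^\- mfn (fun=> funeneg_ge0 _ _).
move: semi; rewrite (integralE _ _ f) !fubini_tonelli1// => s.
apply: integral_diff => //.
- rewrite [X in measurable_fun _ X](_ : _ =
     fun x => fubini_F m2 f^\+ x - fubini_F m2 f^\- x); last first.
    by apply/funext => x; exact: integral_compE.
  exact: emeasurable_funB.
- by move=> x; apply: integral_ge0.
- by move=> x; apply: integral_ge0.
- by apply/aeW => x; exact: integral_compE.
Qed.

Lemma fubini_semi2 : \int[m2]_y \int[m1]_x f (x, y) = \int[m1 \x m2]_z f z.
Proof.
have mF := measurable_fun_fubini_tonelli_G f^\+ mfp (fun=> funepos_ge0 _ _).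
have mF' := measurable_fun_fubini_tonelli_G f^\- mfn (fun=> funeneg_ge0 _ _).
move: semi; rewrite (integralE _ _ f) !fubini_tonelli2// => s.
apply: integral_diff => //.
- rewrite [X in measurable_fun _ X](_ : _ =
     fun x => fubini_G m1 f^\+ x - fubini_G m1 f^\- x); last first.
    by apply/funext => x; exact: integral_compE.
  exact: emeasurable_funB.
- by move=> x; apply: integral_ge0.
- by move=> x; apply: integral_ge0.
- by apply/aeW => x; exact: integral_compE.
Qed.

End fubini_semi.

Lemma ge0_integral_ae_lty {d} {T : measurableType d} {R : realType}
    (mu : {measure set T -> \bar R}) (f : T -> \bar R) :
  measurable_fun setT f -> (forall x, 0 <= f x) -> \int[mu]_x f x < +oo ->
  {ae mu, forall x, f x < +oo}.
Proof.
move=> mf f0 foo; have : mu.-integrable setT f.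
  by apply/integrableP; split => //; under eq_integral do rewrite gee0_abs//.
move=> /(integrable_ae measurableT); apply: filterS => x /(_ I).
by rewrite ge0_fin_numE.
Qed.

Lemma measure_eq_rectangles {d1 d2} {T1 : measurableType d1}
    {T2 : measurableType d2} {R : realType}
    (m1 m2 : {measure set (T1 * T2) -> \bar R}) : m1 setT < +oo ->
  (forall A B, measurable A -> measurable B -> m1 (A `*` B) = m2 (A `*` B)) ->
  forall C, measurable C -> m1 C = m2 C.
Proof.
move=> m1oo m12 C mC.
pose G : set (set (T1 * T2)) := [set A1 `*` A2 | A1 in measurable & A2 in measurable].
apply: (measure_unique G (fun=> setT)) => //.
- by rewrite measurable_prod_measurableType.
- move=> X Y [X1 mX1 [X2 mX2 <-{X}]] [Y1 mY1 [Y2 mY2 <-{Y}]].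
  exists (X1 `&` Y1); first exact: measurableI.
  by exists (X2 `&` Y2); [exact: measurableI|rewrite setXI].
- by move=> _; exists setT => //; exists setT => //; rewrite setXTT.
- by rewrite bigcup_const//; exists 0%N.
- by move=> _ [A mA [B mB <-]]; exact: m12.
Qed.

(** * Conditional laws *)

Section kernel_integral.
Context {d1 d2} {T1 : measurableType d1} {T2 : measurableType d2} {R : realType}.
Variables (kappa : T1 -> probability T2 R).
Hypothesis mkappa : forall B, measurable B ->
  measurable_fun [set: T1] (fun h => kappa h B).

(** Retyped as measure-valued so that it can carry the structure of a probability kernel, from which
    the measurability of parametrized integrals follows. *)
Let K : T1 -> {measure set T2 -> \bar R} := kappa.

HB.instance Definition _ := @isKernel.Build _ _ _ _ _ K mkappa.

Let K1 x : K x [set: T2] = 1. Proof. exact: probability_setT. Qed.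

HB.instance Definition _ := @Kernel_isProbability.Build _ _ _ _ _ K K1.

Lemma measurable_kernel_integral (f : T1 * T2 -> \bar R) :
  measurable_fun setT f -> (forall x, 0 <= f x) ->
  measurable_fun setT (fun t => \int[kappa t]_x f (t, x)).
Proof. by move=> mf f0; exact: (@measurable_kfcomp _ _ _ _ _ K f mf f0). Qed.

Lemma measurable_kernel_xsection (A : set (T1 * T2)) : measurable A ->
  measurable_fun setT (fun t => kappa t (xsection A t)).
Proof.
by move=> mA; apply: (measurable_fun_xsection_finite_kernel K); rewrite inE.
Qed.

(** The parts of the inner integral of [f] are bounded by the inner integrals of [a] and [b], so
    finiteness on one side passes to it. This is what makes iterated expectations of possibly
    undefined conditional expectations usable. *)
Lemma kernel_integral_diff (m : {measure set T1 -> \bar R})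
    (f a b : T1 * T2 -> \bar R) :
  measurable_fun setT f -> measurable_fun setT a -> measurable_fun setT b ->
  (forall x, 0 <= a x) -> (forall x, 0 <= b x) ->
  (forall x, f x = a x - b x) ->
  \int[m]_t \int[kappa t]_x a (t, x) < +oo \/
  \int[m]_t \int[kappa t]_x b (t, x) < +oo ->
  [/\ measurable_fun setT (fun t => \int[kappa t]_x f (t, x)),
     \int[m]_t (fun t => \int[kappa t]_x f (t, x))^\+ t < +oo \/
     \int[m]_t (fun t => \int[kappa t]_x f (t, x))^\- t < +oo &
  \int[m]_t \int[kappa t]_x f (t, x) =
  \int[m]_t \int[kappa t]_x a (t, x) - \int[m]_t \int[kappa t]_x b (t, x)].
Proof.
move=> mf ma mb a0 b0 fab s.
pose F t := \int[kappa t]_x f (t, x).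
pose A t := \int[kappa t]_x a (t, x).
pose B t := \int[kappa t]_x b (t, x).
have A0 t : 0 <= A t by exact: integral_ge0.
have B0 t : 0 <= B t by exact: integral_ge0.
have mA : measurable_fun setT A by exact: measurable_kernel_integral.
have mB : measurable_fun setT B by exact: measurable_kernel_integral.
have mfp : measurable_fun setT f^\+ by exact: measurable_funepos.
have mfn : measurable_fun setT f^\- by exact: measurable_funeneg.
have Fpn : F = fun t => \int[kappa t]_x f^\+ (t, x) - \int[kappa t]_x f^\- (t, x).
  by apply/funext => t; exact: integral_compE.
have mF : measurable_fun setT F.
  rewrite Fpn; apply: emeasurable_funB;
  by apply: measurable_kernel_integral.
have sub u v : 0 <= u -> 0 <= v ->
    maxe (u - v) 0 <= u /\ maxe (- (u - v)) 0 <= v :> \bar R.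
  move: u v => [u| |] [v| |]//= u0 v0; rewrite !ge_max ?leey ?leNye ?u0 ?v0//=.
  by move: u0 v0; rewrite -?EFinN -?EFinD !lee_fin => u0 v0; split;
    apply/andP; split => //; lra.
have FA t : F^\+ t <= A t.
  rewrite funeposE Fpn; apply: (le_trans (sub _ _ _ _).1).
  - exact: integral_ge0.
  - exact: integral_ge0.
  - apply: ge0_le_integral => //; try exact: measurableT_comp.
    by move=> x _; rewrite funeposE fab (sub _ _ _ _).1.
have FB t : F^\- t <= B t.
  rewrite funenegE Fpn; apply: (le_trans (sub _ _ _ _).2).
  - exact: integral_ge0.
  - exact: integral_ge0.
  - apply: ge0_le_integral => //; try exact: measurableT_comp.
    by move=> x _; rewrite funenegE fab (sub _ _ _ _).2.
split => //.
  case: s => s; [left|right]; apply: le_lt_trans s; apply: ge0_le_integral => //.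
  exact: measurable_funepos.
  exact: measurable_funeneg.
apply: integral_diff => //.
(* Where [A t] and [B t] are both infinite, [F t] may differ from [A t - B t]; finiteness of one
   outer integral makes such [t] negligible. *)
have FAB t : A t < +oo \/ B t < +oo -> F t = A t - B t.
  move=> AB; apply: integral_diff => //; try exact: measurableT_comp.
  exact: aeW.
by case: s => s; [have := ge0_integral_ae_lty mA A0 s|have := ge0_integral_ae_lty mB B0 s];
  apply: filterS => t ty; apply: FAB; [left|right].
Qed.

End kernel_integral.

Section disintegration.
Context {dO d1 d2} {Omega : measurableType dO} {T1 : measurableType d1}
  {T2 : measurableType d2} {R : realType}.
Variables (Pr : probability Omega R) (H : Omega -> T1) (X : Omega -> T2)
  (kappa : T1 -> probability T2 R).
Hypothesis cl : conditional_law Pr H X kappa.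

Let mH : measurable_fun setT H. Proof. by case: cl. Qed.
Let mX : measurable_fun setT X. Proof. by case: cl. Qed.
Let mk : forall B, measurable B -> measurable_fun [set: T1] (fun h => kappa h B).
Proof. by case: cl. Qed.

Let joint w := (H w, X w).
Let mjoint : measurable_fun setT joint.
Proof. exact: measurable_fun_pair. Qed.

(** The candidate for the joint law of [(H, X)] given the outcome, to be averaged over [Pr]. The
    dummy [unit] turns [Pr] into a kernel, so that the average is a composition of kernels. *)
Let D (x : unit * Omega) : {measure set (T1 * T2) -> \bar R} :=
  \d_(H x.2) \x kappa (H x.2).

Let DE x U : measurable U -> D x U = kappa (H x.2) (xsection U (H x.2)).
Proof.
move=> mU; transitivity (\int[\d_(H x.2)]_h kappa (H x.2) (xsection U h)) => //.
rewrite integral_dirac ?diracT ?mul1e//; exact: measurable_fun_xsection.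
Qed.

Let mD U : measurable U -> measurable_fun setT (D ^~ U).
Proof.
move=> mU; rewrite (_ : D ^~ U =
    (fun h => kappa h (xsection U h)) \o H \o snd); last first.
  by apply/funext => x; rewrite DE.
do 2 (apply: measurableT_comp => //); exact: measurable_kernel_xsection.
Qed.

HB.instance Definition _ := @isKernel.Build _ _ _ _ _ D mD.

Let D1 x : D x [set: T1 * T2] = 1.
Proof. by rewrite DE// /xsection/= (_ : [set y | _] = setT) ?probability_setT//;
  apply/seteqP; split => // y _ /=; rewrite inE. Qed.
HB.instance Definition _ := @Kernel_isProbability.Build _ _ _ _ _ D D1.

Let C (x : unit) : {measure set Omega -> \bar R} := Pr.
Let mC U : measurable U -> measurable_fun setT (C ^~ U).
Proof. by move=> mU; exact: measurable_cst. Qed.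
HB.instance Definition _ := @isKernel.Build _ _ _ _ _ C mC.
Let C1 x : C x [set: Omega] = 1. Proof. exact: probability_setT. Qed.
HB.instance Definition _ := @Kernel_isProbability.Build _ _ _ _ _ C C1.

(** Both sides are integrals of [f] against measures on [T1 * T2]; the definition of a conditional
    law says exactly that these agree on rectangles, and rectangles determine a finite measure. *)
Lemma integral_conditional_law (f : T1 * T2 -> \bar R) :
  measurable_fun setT f -> (forall x, 0 <= f x) ->
  \int[Pr]_w f (H w, X w) = \int[Pr]_w \int[kappa (H w)]_x f (H w, x).
Proof.
move=> mf f0.
transitivity (\int[kcomp C D tt]_x f x); last first.
  rewrite integral_kcomp//; apply: eq_integral => w _.
  rewrite fubini_tonelli1// integral_dirac ?diracT ?mul1e//.
  exact: measurable_fun_fubini_tonelli_F.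
have /= <- := ge0_integral_pushforward mjoint Pr measurableT mf (fun x _ => f0 x).
apply: eq_measure_integral => A mA _; apply: measure_eq_rectangles => //.
  by rewrite /= /pushforward/= preimage_setT probability_setT ltry.
move=> U V mU mV; transitivity (Pr (H @^-1` U `&` X @^-1` V)) => //.
case: (cl) => _ _ _ -> //; rewrite integral_mkcond; apply: eq_integral => w _.
rewrite DE//=; last exact: measurableX.
rewrite patchE; case: ifPn => [|] wU.
  by rewrite in_xsectionX// -in_preimage.
by rewrite notin_xsectionX ?measure0// -in_preimage.
Qed.

End disintegration.

(** * Replacing a data point by a fresh one *)

Section resample.
Context {d} {Zt : measurableType d} {n : nat}.

Definition resample (i : nat) (s : n.-tuple Zt) (z : Zt) : n.-tuple Zt :=
  [tuple if j == i :> nat then z else tnth s j | j < n].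

Lemma measurable_resample i :
  measurable_fun [set: n.-tuple Zt * Zt] (fun x => resample i x.1 x.2).
Proof.
apply/measurable_fun_tnthP => j.
rewrite (_ : _ \o _ = fun x => if j == i :> nat then x.2 else tnth x.1 j); last first.
  by apply/funext => x /=; rewrite tnth_mktuple.
case: (j == i :> nat); first exact: measurable_snd.
exact: (@measurableT_comp _ _ _ _ _ _ _ setT fst (measurable_tnth j) measurable_fst).
Qed.

Definition cylinder (A : nat -> set Zt) : set (n.-tuple Zt) :=
  [set s | forall j : 'I_n, A j (tnth s j)].

Lemma measurable_cylinder A : (forall k, measurable (A k)) ->
  measurable (cylinder A).
Proof.
move=> mA; rewrite (_ : cylinder A =
    \bigcap_(j in [set: 'I_n]) ((@tnth n Zt ^~ j) @^-1` A j)); last first.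
  by apply/seteqP; split => [s As j _|s As j]; exact: As.
apply: fin_bigcap_measurable => [|j _]; first exact: finite_finset.
by rewrite -[X in measurable X]setTI; exact: measurable_tnth.
Qed.

Lemma measurable_tupleE :
  @measurable _ (n.-tuple Zt) =
  <<s [set cylinder A | A in [set A | forall k, measurable (A k)]] >>.
Proof.
apply/seteqP; split; apply: smallest_sub.
- exact: smallest_sigma_algebra.
- move=> B; rewrite -bigcup_seq/= => -[i _ [A mA <-]].
  apply: sub_sigma_algebra.
  exists (fun k => if k == i :> nat then A else setT) => [k|].
    by case: ifP.
  apply/seteqP; split => [s /(_ i)|s [_ /= As] j]; first by rewrite eqxx.
  by case: eqP => // /val_inj ->.
- exact: sigma_algebra_measurable.
- by move=> _ [A mA <-]; exact: measurable_cylinder.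
Qed.

(** Cylinders are stable under intersection and generate the sigma-algebra of tuples. Independence
    prescribes the law of the sample precisely on them. *)
Lemma tuple_measure_unique {R : realType}
    (m1 m2 : {measure set (n.-tuple Zt) -> \bar R}) : m1 setT < +oo ->
  (forall A, (forall k, measurable (A k)) ->
     m1 (cylinder A) = m2 (cylinder A)) ->
  forall B, measurable B -> m1 B = m2 B.
Proof.
move=> m1oo m12 B mB.
apply: (measure_unique
  [set cylinder A | A in [set A | forall k, measurable (A k)]] (fun=> setT)) => //.
- exact: measurable_tupleE.
- move=> _ _ [A mA <-] [A' mA' <-].
  exists (fun k => A k `&` A' k) => [k|]; first exact: measurableI.
  by apply/seteqP; split => [s As|s [As A's] j]; split => // j; case: (As j).
- by move=> _; exists (fun=> setT) => //; apply/seteqP; split.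
- by rewrite bigcup_const//; exists 0%N.
- by move=> _ [A mA <-]; exact: m12.
Qed.

End resample.

Section fresh_point.
Context {dO d} {Omega : measurableType dO} {Zt : measurableType d} {R : realType}.
Variables (Pr : probability Omega R) (P : probability Zt R) (n : nat)
  (Z : nat -> Omega -> Zt).
Hypothesis iidZ : iid Pr P n Z.

Lemma measurable_sample : measurable_fun setT (sample n Z).
Proof.
apply/measurable_fun_tnthP => j; rewrite (_ : _ \o _ = Z j).
  by case: iidZ => /(_ j) + _ _; apply.
by apply/funext => w /=; rewrite tnth_mktuple.
Qed.

Lemma sample_cylinder A : (forall k, measurable (A k)) ->
  Pr (sample n Z @^-1` cylinder A) = \prod_(k < n) P (A k).
Proof.
move=> mA; rewrite (_ : _ @^-1` _ = \bigcap_(k in `I_n) (Z k @^-1` A k)).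
  case: iidZ => _ ZP -> //; apply: eq_bigr => k _; exact: ZP.
apply/seteqP; split => w /= Aw.
  by move=> k /= kn; have := Aw (Ordinal kn); rewrite tnth_mktuple.
by move=> j; rewrite tnth_mktuple; apply: Aw => /=.
Qed.

(** Both laws give a cylinder the product of the [P (A k)]: after resampling, coordinate [i] of the
    sample is left free and its factor [P (A i)] comes from the fresh point. *)
Lemma integral_resample i (f : n.-tuple Zt -> \bar R) : (i < n)%N ->
  measurable_fun setT f -> (forall s, 0 <= f s) ->
  \int[Pr]_w f (sample n Z w) =
  \int[Pr \x P]_x f (resample i (sample n Z x.1) x.2).
Proof.
move=> ltin mf f0.
have ms := measurable_sample.
have mr : measurable_fun [set: Omega * Zt]
    (fun x => resample i (sample n Z x.1) x.2).
  apply: (@measurableT_comp _ _ _ _ _ _ (fun x => resample i x.1 x.2)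
    _ (fun x : Omega * Zt => (sample n Z x.1, x.2))).
    exact: measurable_resample.
  by apply/measurable_fun_pair => //; exact: measurableT_comp.
have /= <- := ge0_integral_pushforward ms Pr measurableT mf (fun s _ => f0 s).
have /= <- := ge0_integral_pushforward mr (Pr \x P) measurableT mf (fun s _ => f0 s).
apply: eq_measure_integral => B mB _; apply: tuple_measure_unique => //.
  by rewrite /= /pushforward/= preimage_setT probability_setT ltry.
move=> A mA.
transitivity (Pr (sample n Z @^-1` cylinder A)) => //.
transitivity ((Pr \x P) (sample n Z @^-1` cylinder
    (fun k => if k == i then setT else A k) `*` A i)); last first.
  congr ((Pr \x P) _); apply/seteqP; split => [[w z] /= [Aw Az] j|[w z] /= Awz].
    rewrite tnth_mktuple; case: eqP => [->//|ji].
    by have /= := Aw j; case: eqP ji.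
  split.
    by move=> j; case: eqP => // ji; have := Awz j; rewrite tnth_mktuple; case: eqP.
  by have := Awz (Ordinal ltin); rewrite tnth_mktuple /= eqxx.
have mA' k : measurable (if k == i then setT else A k) by case: ifP.
transitivity (Pr (sample n Z @^-1` cylinder
    (fun k => if k == i then setT else A k)) * P (A i)); last first.
  apply/esym/product_measure1E => //; rewrite -[X in measurable X]setTI.
  by apply: ms => //; exact: measurable_cylinder.
rewrite sample_cylinder// sample_cylinder//.
rewrite (bigD1 (Ordinal ltin))//= [in RHS](bigD1 (Ordinal ltin))//= eqxx.
rewrite probability_setT mul1e muleC; congr (_ * _).
by apply: eq_bigr => k; rewrite -val_eqE /= => /negbTE ->.
Qed.

End fresh_point.

(** * Pairing data points with draws *)

Lemma zip_take {S T : Type} (s : seq S) (c : seq T) :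
  zip (take (size c) s) c = zip s c.
Proof.
by elim: s c => [|x s IHs] [|y c] //=; rewrite IHs.
Qed.

Lemma zip_rcons_nth {S T : Type} (x0 : S) (s : seq S) (c : seq T) (y : T) :
  (size c < size s)%N ->
  zip s (rcons c y) = rcons (zip s c) (nth x0 s (size c), y).
Proof.
elim: c s => [|b c IHc] [|a s] //=; first by case: s.
by rewrite ltnS => /IHc ->.
Qed.

Lemma take_resample {d} {Zt : measurableType d} {n : nat} (i k : nat)
    (s : n.-tuple Zt) (z : Zt) :
  (k <= i)%N -> take k (resample i s z) = take k s.
Proof.
move=> ki; apply: (@eq_from_nth _ z); rewrite !size_take ?size_tuple//.
move=> j jk.
move: jk; rewrite -/(minn k n) leq_min => /andP[jk jn].
rewrite !nth_take// -[j]/(val (Ordinal jn)) -!tnth_nth tnth_mktuple /=.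
by case: eqP => // ji; lia.
Qed.

(** [zip] stops at the end of [c], hence before reading the entry of index [i]. This is how the
    algorithm's ignorance of later data enters the proof. *)
Lemma zip_resample {d} {Zt : measurableType d} {T : Type} {n : nat} (i : nat)
    (s : n.-tuple Zt) (z : Zt) (c : seq T) :
  (size c <= i)%N -> zip (resample i s z) c = zip s c.
Proof. by move=> ci; rewrite -zip_take take_resample// zip_take. Qed.

Lemma zip_rcons_resample {d} {Zt : measurableType d} {T : Type} {n : nat} (i : nat)
    (s : n.-tuple Zt) (z : Zt) (c : seq T) (y : T) : (i < n)%N ->
  size c = i -> zip (resample i s z) (rcons c y) = rcons (zip s c) (z, y).
Proof.
move=> ltin ci; rewrite (zip_rcons_nth z) ?size_tuple ?ci// zip_resample ?ci//.
by rewrite -[i in nth _ _ i]/(val (Ordinal ltin)) -tnth_nth tnth_mktuple eqxx.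
Qed.

(** [seq U] carries no sigma-algebra; for sequences of constant length this
    predicate plays the role of measurability. *)
Inductive measurable_list {d d'} {T : measurableType d} {U : measurableType d'} :
    (T -> seq U) -> Prop :=
| measurable_list_nil : measurable_list (fun=> [::])
| measurable_list_rcons l f : measurable_list l -> measurable_fun setT f ->
    measurable_list (fun t => rcons (l t) (f t)).

Section measurable_list_theory.
Context {d d' d''} {S : measurableType d''} {T : measurableType d}
  {U : measurableType d'}.

Lemma measurable_list_comp (l : T -> seq U) (f : S -> T) :
  measurable_list l -> measurable_fun setT f -> measurable_list (l \o f).
Proof.
move=> ml mf; elim: ml => [|l0 u _ IHl mu]; first exact: measurable_list_nil.
by apply: (measurable_list_rcons IHl); exact: measurableT_comp mu mf.
Qed.

Lemma measurable_list_map (f : nat -> T -> U) k :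
  (forall i, (i < k)%N -> measurable_fun setT (f i)) ->
  measurable_list (fun t => [seq f i t | i <- iota 0 k]).
Proof.
elim: k => [|k IHk] mf; first exact: measurable_list_nil.
rewrite (_ : (fun t => _) =
    fun t => rcons [seq f i t | i <- iota 0 k] (f k t)); last first.
  by apply/funext => t; rewrite -map_rcons -cats1 -(iotaD 0 k 1) addn1.
by apply: measurable_list_rcons; [apply: IHk => i ik; apply: mf; exact: ltnW|exact: mf].
Qed.

End measurable_list_theory.

Lemma measurable_list_zip {d d'} {Zt : measurableType d} {Gb : measurableType d'}
    (n k : nat) :
  measurable_list (fun h : n.-tuple Zt * k.-tuple Gb => zip h.1 h.2).
Proof.
rewrite (_ : (fun h => _) = fun h : n.-tuple Zt * k.-tuple Gb =>
    [seq (nth point h.1 i, nth point h.2 i) | i <- iota 0 (minn n k)]).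
  apply: measurable_list_map => i; rewrite leq_min => /andP[ltin ik].
  apply/measurable_fun_pair.
    rewrite (_ : (fun h => _) = (fun s => tnth s (Ordinal ltin)) \o fst).
      exact: (measurableT_comp (measurable_tnth (Ordinal ltin)) measurable_fst).
    by apply/funext => h /=; rewrite (tnth_nth point).
  rewrite (_ : (fun h => _) = (fun s => tnth s (Ordinal ik)) \o snd).
    exact: (measurableT_comp (measurable_tnth (Ordinal ik)) measurable_snd).
  by apply/funext => h /=; rewrite (tnth_nth point).
apply/funext => h; apply: (@eq_from_nth _ (point, point)).
  by rewrite size_map size_iota size_zip !size_tuple.
move=> i; rewrite size_zip !size_tuple => ik.
rewrite (nth_map 0%N) ?size_iota// nth_iota// add0n nth_zip_cond size_zip.
by rewrite !size_tuple ik.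
Qed.

Section fresh_draw.
Context {dZ dB dG dO} {Zt : measurableType dZ} {Gb : measurableType dB}
  {G : measurableType dG} {Omega : measurableType dO} {R : realType}.
Variables (incl : G -> Gb) (L : Zt -> Gb -> R) (delta : Zt -> G -> Gb -> R)
  (lambda : R) (pi : probability G R)
  (pihat : probability G R -> probability Gb R)
  (Pr : probability Omega R) (P : probability Zt R) (n : nat)
  (Z : nat -> Omega -> Zt) (ghat : nat -> Omega -> Gb).
Hypothesis iidZ : iid Pr P n Z.
Hypothesis draw : forall i, (i <= n)%N ->
  conditional_law Pr (history n Z ghat i) (ghat i)
    (rhohat incl L delta lambda pi pihat (i := i)).

Lemma historyS k w : history n Z ghat k.+1 w =
  ((history n Z ghat k w).1, [tuple of rcons (history n Z ghat k w).2 (ghat k w)]).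
Proof.
congr pair; apply: eq_from_tnth => j; rewrite tnth_mktuple (tnth_nth point).
rewrite nth_rcons size_tuple; case: ltnP => jk.
  by rewrite -[j in nth _ _ j]/(val (Ordinal jk)) -tnth_nth tnth_mktuple.
have -> : j = k :> nat by apply/eqP; rewrite eqn_leq jk -ltnS ltn_ord.
by rewrite eqxx.
Qed.

Lemma measurable_rcons_tuple k :
  measurable_fun setT (fun x : (n.-tuple Zt * k.-tuple Gb) * Gb =>
    (x.1.1, [tuple of rcons x.1.2 x.2]) : n.-tuple Zt * k.+1.-tuple Gb).
Proof.
apply/measurable_fun_pair => /=; first exact: measurableT_comp.
apply/measurable_fun_tnthP => j.
have [jk|kj] := ltnP j k.
  rewrite (_ : _ \o _ = (fun c => tnth c (Ordinal jk)) \o snd \o fst).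
    apply: (measurableT_comp (measurable_tnth (Ordinal jk))).
    exact: measurableT_comp.
  by apply/funext => x /=; rewrite !(tnth_nth point) nth_rcons size_tuple jk.
rewrite (_ : _ \o _ = snd); first exact: measurable_snd.
apply/funext => x /=; rewrite (tnth_nth point) nth_rcons size_tuple ltnNge kj/=.
by rewrite eqn_leq kj -ltnS ltn_ord.
Qed.

Lemma measurable_history k : (k <= n)%N -> measurable_fun setT (history n Z ghat k).
Proof. by move=> /draw[]. Qed.

(** Induction on the number of draws. Without draws this is exchangeability with the fresh point;
    each further draw of index at most [i] has a conditional law blind to data point [i], so the
    replacement commutes with drawing. *)
Lemma integral_history_resample i k (f : n.-tuple Zt * k.-tuple Gb -> \bar R) :
  (i < n)%N -> (k <= i.+1)%N ->
  measurable_fun setT f -> (forall h, 0 <= f h) ->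
  \int[Pr]_w f (history n Z ghat k w) =
  \int[Pr \x P]_x f (resample i (history n Z ghat k x.1).1 x.2,
                     (history n Z ghat k x.1).2).
Proof.
move=> ltin; elim: k f => [|k IHk] f ki mf f0.
  have mpair : measurable_fun setT (fun s : n.-tuple Zt => f (s, [tuple])).
    by apply: (measurableT_comp mf); exact: measurable_fun_pair.
  transitivity (\int[Pr]_w f (sample n Z w, [tuple])).
    by apply: eq_integral => w _; congr (f (_, _)); apply/val_inj; rewrite tuple0.
  rewrite (integral_resample iidZ ltin mpair)//.
  by apply: eq_integral => w _; congr (f (_, _)); apply/val_inj; rewrite [in RHS]tuple0.
have kn : (k <= n)%N by lia.
pose g (x : (n.-tuple Zt * k.-tuple Gb) * Gb) := f (x.1.1, [tuple of rcons x.1.2 x.2]).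
have mg : measurable_fun setT g := measurableT_comp mf (@measurable_rcons_tuple k).
have g0 x : 0 <= g x by exact: f0.
pose rho (h : n.-tuple Zt * k.-tuple Gb) := rhohat incl L delta lambda pi pihat (i := k) h.
have mrho : forall B, measurable B -> measurable_fun setT (fun h => rho h B).
  by case: (draw kn).
have rhoE s z c : rho (resample i s z, c) = rho (s, c).
  by rewrite /rho /rhohat/= zip_resample// size_tuple.
transitivity (\int[Pr]_w g (history n Z ghat k w, ghat k w)).
  by apply: eq_integral => w _; rewrite historyS.
rewrite (integral_conditional_law (draw kn) mg g0) -/rho.
rewrite (IHk (fun h => \int[rho h]_x g (h, x))); first last.
- by move=> h; exact: integral_ge0.
- exact: measurable_kernel_integral.
- exact: ltnW.
have mh := measurable_history kn.
have mres : measurable_fun [set: (n.-tuple Zt * k.-tuple Gb) * Zt]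
    (fun x => (resample i x.1.1 x.2, x.1.2)).
  apply/measurable_fun_pair; last exact: measurableT_comp.
  apply: (measurableT_comp (measurable_resample i)
    (g := fun x : (n.-tuple Zt * k.-tuple Gb) * Zt => (x.1.1, x.2))).
  by apply/measurable_fun_pair => //; exact: measurableT_comp.
have mhz : measurable_fun [set: Omega * Zt]
    (fun x => (resample i (history n Z ghat k x.1).1 x.2, (history n Z ghat k x.1).2)).
  apply: (measurableT_comp mres
    (g := fun x : Omega * Zt => (history n Z ghat k x.1, x.2))).
  by apply/measurable_fun_pair => //; exact: measurableT_comp.
have mghat : measurable_fun setT (ghat k) by case: (draw kn).
have mK := measurable_kernel_integral mrho mg g0.
rewrite fubini_tonelli2; first last.
- by move=> x; exact: integral_ge0.
- exact: (measurableT_comp mK mhz).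
rewrite fubini_tonelli2; first last.
- by move=> x; exact: f0.
- rewrite (_ : (fun x => _) = (fun x : Omega * Zt => g
      ((resample i (history n Z ghat k x.1).1 x.2, (history n Z ghat k x.1).2),
       ghat k x.1))); last by apply/funext => x; rewrite historyS.
  apply: (measurableT_comp mg (g := fun x : Omega * Zt =>
    ((resample i (history n Z ghat k x.1).1 x.2, (history n Z ghat k x.1).2),
     ghat k x.1))).
  by apply/measurable_fun_pair => //; exact: measurableT_comp.
(* With the fresh value [z] frozen, [rhoE] identifies the law of the draw with that for the original
   history, so the conditioning can be undone. *)
apply: eq_integral => z _; rewrite /fubini_G.
pose gz x := g ((resample i x.1.1 z, x.1.2), x.2).
have mgz : measurable_fun setT gz.
  apply: (measurableT_comp mg
    (g := fun x : (n.-tuple Zt * k.-tuple Gb) * Gb => ((resample i x.1.1 z, x.1.2), x.2))).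
  apply/measurable_fun_pair => //; apply: (measurableT_comp mres
    (g := fun x : (n.-tuple Zt * k.-tuple Gb) * Gb => (x.1, z))).
  by apply/measurable_fun_pair.
transitivity (\int[Pr]_w gz (history n Z ghat k w, ghat k w)); last first.
  by apply: eq_integral => w _; rewrite historyS.
transitivity (\int[Pr]_w \int[rho (history n Z ghat k w)]_x
    gz (history n Z ghat k w, x)).
  by apply: eq_integral => w _; rewrite rhoE.
exact/esym/(integral_conditional_law (draw kn) mgz (fun=> g0 _)).
Qed.

(** Since [ghat i] is drawn using only the data points of index less than [i],
    the data point of index [i] is as good as a fresh one. *)
Lemma integral_fresh i (f : seq (Zt * Gb) -> \bar R) : (i < n)%N ->
  measurable_fun setT (fun h : n.-tuple Zt * i.+1.-tuple Gb => f (zip h.1 h.2)) ->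
  (forall l, 0 <= f l) ->
  \int[Pr]_w f (zip (sample n Z w) (history n Z ghat i.+1 w).2) =
  \int[Pr \x P]_x
    f (rcons (zip (sample n Z x.1) (history n Z ghat i x.1).2) (x.2, ghat i x.1)).
Proof.
move=> ltin mf f0.
rewrite (integral_history_resample ltin (leqnn _) mf)//.
apply: eq_integral => x _; rewrite historyS /= zip_rcons_resample//.
by rewrite size_map size_enum_ord.
Qed.

End fresh_draw.

(** * Gibbs distributions and the potential *)

Lemma measurable_lne (R : realType) : measurable_fun setT (@lne R).
Proof.
rewrite (_ : @lne R = fun x => if x <= 0 then -oo else
   if x == +oo then +oo else (ln (fine x))%:E); last first.
  by apply/funext => -[r| |] /=; rewrite ?leNye ?lee_fin.
apply: measurable_fun_ifT => //.
  apply: (measurable_fun_bool true);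
  exact: (emeasurable_fun_infty_c measurableT (@measurable_id _ _ setT)).
apply: measurable_fun_ifT => //.
  apply: (measurable_fun_bool true); rewrite setTI.
  rewrite (_ : _ @^-1` _ = [set +oo]); first exact: emeasurable_set1.
  by apply/seteqP; split => x /= /eqP.
by apply/measurable_EFinP; apply: (measurableT_comp (@measurable_ln R)).
Qed.

Section density.
Context {d} {T : measurableType d} {R : realType}.
Variables (nu : {finite_measure set T -> \bar R})
  (mu : {sigma_finite_measure set T -> \bar R}) (p : T -> \bar R).
Hypotheses (mp : measurable_fun setT p)
  (nup : forall A, measurable A -> nu A = \int[mu]_(x in A) p x).

Let numu : nu `<< mu.
Proof.
apply/null_content_dominatesP => A mA A0; rewrite nup//.
apply: null_set_integral => //; exact: measurable_funS mp.
Qed.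

Let density_ae : ae_eq mu setT (Radon_Nikodym_SigmaFinite.f nu mu) p.
Proof.
apply: integral_ae_eq => //; first exact: Radon_Nikodym_SigmaFinite.f_integrable.
by move=> E _ mE; rewrite -Radon_Nikodym_SigmaFinite.f_integral// nup.
Qed.

(** A function reproducing [nu] on all measurable sets is almost everywhere the Radon-Nikodym
    derivative, so the change of variables passes to it. *)
Lemma integral_density (f : T -> \bar R) :
  measurable_fun setT f -> (forall x, 0 <= f x) ->
  \int[nu]_x f x = \int[mu]_x (f x * p x).
Proof.
move=> mf f0; rewrite -(Radon_Nikodym_SigmaFinite.change_of_variables numu)//.
have mRN := measurable_int _ (Radon_Nikodym_SigmaFinite.f_integrable numu).
apply: ae_eq_integral => //; try exact: emeasurable_funM.
by apply: filterS density_ae => x + xT => /(_ xT) ->.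
Qed.

End density.

Section gibbs_theory.
Context {d} {T : measurableType d} {R : realType}.
Variables (pi : probability T R) (h : T -> R).
Hypothesis mh : measurable_fun setT h.

Let W := \int[pi]_x (expR (- h x))%:E.
Hypothesis Woo : W < +oo.

Let mexp : measurable_fun setT (fun x => (expR (- h x))%:E).
Proof.
apply/measurable_EFinP; apply: measurableT_comp => //; exact: measurable_funN.
Qed.

Let W0 : 0 < W. Proof. by apply: integral_gt0 => // x; rewrite lte_fin expR_gt0. Qed.

(** A normalizing constant strictly between 0 and [+oo] excludes the default branches of
    [mnormalize]. *)
Lemma gibbsE A : measurable A ->
  gibbs pi h A = \int[pi]_(x in A) ((expR (- h x))%:E * (fine W)^-1%:E).
Proof.
move=> mA; rewrite ge0_integralZr//; first last.
- by rewrite lee_fin invr_ge0 fine_ge0// ltW.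
- exact: measurable_funS mexp.
have wE B : gibbs_weight pi h B = \int[pi]_(x in B) (expR (- h x))%:E.
  by rewrite /gibbs_weight; case: asboolP.
pose w := gibbs_weight pi h; transitivity
  ((if (w setT == 0) || (w setT == +oo) then fun U => pi U
    else fun U => w U * (fine (w setT))^-1%:E) A) => //.
by rewrite /w !wE -/W gt_eqF// lt_eqF//= wE.
Qed.

Lemma integral_gibbs (f : T -> \bar R) :
  measurable_fun setT f -> (forall x, 0 <= f x) ->
  \int[gibbs pi h]_x f x =
  \int[pi]_x (f x * (expR (- h x))%:E) * (fine W)^-1%:E.
Proof.
move=> mf f0; rewrite (integral_density _ gibbsE)//; last exact: emeasurable_funM.
under eq_integral do rewrite muleA.
rewrite ge0_integralZr//.
- exact: emeasurable_funM.
- by move=> x _; rewrite mule_ge0// lee_fin expR_ge0.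
- by rewrite lee_fin invr_ge0 fine_ge0// ltW.
Qed.

End gibbs_theory.

Section potential.
Context {dZ dB dG} {Zt : measurableType dZ} {Gb : measurableType dB}
  {G : measurableType dG} {R : realType}.
Variables (incl : G -> Gb) (L : Zt -> Gb -> R) (delta : Zt -> G -> Gb -> R)
  (lambda : R) (pi : probability G R).
Hypotheses (mL : measurable_fun [set: Zt * Gb] (fun x => L x.1 x.2))
  (mLi : measurable_fun [set: Zt * G] (fun x => L x.1 (incl x.2)))
  (md : measurable_fun [set: Zt * G * Gb] (fun x => delta x.1.1 x.1.2 x.2)).

Local Notation S := (cumulative_loss incl L delta).

Definition partition_function (l : seq (Zt * Gb)) : \bar R :=
  \int[pi]_g (expR (- (lambda * S l g)))%:E.

(** When [partition_function l = +oo] the Gibbs distribution is a junk value, but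
    then [potential l = +oo] and [potential_step] holds trivially. *)
Definition potential (l : seq (Zt * Gb)) : \bar R :=
  (lambda * \sum_(p <- l) L p.1 p.2)%:E + lne (partition_function l).

Lemma cumulative_loss_rcons l p g :
  S (rcons l p) g = (S l g + L p.1 (incl g) + delta p.1 g p.2)%R.
Proof. by rewrite /cumulative_loss foldl_rcons. Qed.

Lemma measurable_cumulative_loss {d} {T : measurableType d} (l : T -> seq (Zt * Gb)) :
  measurable_list l -> measurable_fun [set: T * G] (fun x => S (l x.1) x.2).
Proof.
elim => [|l0 f _ IHl mf]; first exact: measurable_cst.
rewrite (_ : (fun x => _) = fun x : T * G => (S (l0 x.1) x.2 +
    L (f x.1).1 (incl x.2) + delta (f x.1).1 x.2 (f x.1).2)%R); last first.
  by apply/funext => x; rewrite cumulative_loss_rcons.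
have mf1 : measurable_fun [set: T * G] (fun x => (f x.1).1).
  by do 2 (apply: measurableT_comp => //).
have mf2 : measurable_fun [set: T * G] (fun x => (f x.1).2).
  by do 2 (apply: measurableT_comp => //).
apply: measurable_funD; first apply: measurable_funD => //.
- apply: (measurableT_comp mLi (g := fun x : T * G => ((f x.1).1, x.2))).
  by apply/measurable_fun_pair.
- apply: (measurableT_comp md (g := fun x : T * G => (((f x.1).1, x.2), (f x.1).2))).
  by apply/measurable_fun_pair => //; apply/measurable_fun_pair.
Qed.

Lemma measurable_sum_loss {d} {T : measurableType d} (l : T -> seq (Zt * Gb)) :
  measurable_list l -> measurable_fun [set: T] (fun x => \sum_(p <- l x) L p.1 p.2)%R.
Proof.
elim => [|l0 f _ IHl mf].
  rewrite (_ : (fun x => _) = cst 0%R); first exact: measurable_cst.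
  by apply/funext => x; rewrite big_nil.
rewrite (_ : (fun x => _) =
    fun x => (\sum_(p <- l0 x) L p.1 p.2 + L (f x).1 (f x).2)%R); last first.
  by apply/funext => x; rewrite big_rcons.
by apply: measurable_funD => //; exact: (measurableT_comp mL mf).
Qed.

Lemma measurable_partition_function {d} {T : measurableType d} (l : T -> seq (Zt * Gb)) :
  measurable_list l -> measurable_fun [set: T] (fun x => partition_function (l x)).
Proof.
move=> ml; apply: (measurable_fun_fubini_tonelli_F
  (fun x : T * G => (expR (- (lambda * S (l x.1) x.2)))%:E)) => //.
  apply/measurable_EFinP; apply: measurableT_comp => //; apply: measurable_funN.
  by apply: measurable_funM => //; exact: measurable_cumulative_loss.
Qed.

Lemma measurable_potential {d} {T : measurableType d} (l : T -> seq (Zt * Gb)) :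
  measurable_list l -> measurable_fun [set: T] (fun x => potential (l x)).
Proof.
move=> ml; apply: emeasurable_funD.
  by apply/measurable_EFinP/measurable_funM => //; exact: measurable_sum_loss.
by apply: (measurableT_comp (@measurable_lne R)); exact: measurable_partition_function.
Qed.

End potential.

(** * One step of the potential under the variance inequality *)

Section step.
Context {dZ dB dG} {Zt : measurableType dZ} {Gb : measurableType dB}
  {G : measurableType dG} {R : realType}.
Variables (incl : G -> Gb) (L : Zt -> Gb -> R) (delta : Zt -> G -> Gb -> R)
  (lambda : R) (pi : probability G R).
Hypotheses (mL : measurable_fun [set: Zt * Gb] (fun x => L x.1 x.2))
  (mLi : measurable_fun [set: Zt * G] (fun x => L x.1 (incl x.2)))
  (md : measurable_fun [set: Zt * G * Gb] (fun x => delta x.1.1 x.1.2 x.2)).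
Variables (PP : set (probability Zt R))
  (pihat : probability G R -> probability Gb R) (P : probability Zt R).
Hypotheses (vi : variance_inequality incl L delta lambda PP pihat) (PPP : PP P).

Local Notation S := (cumulative_loss incl L delta).
Local Notation W := (partition_function incl L delta lambda pi).
Local Notation N := (potential incl L delta lambda pi).
Local Notation gib l := (gibbs pi (fun g => lambda * S l g)%R).
Local Notation mgf rho := (fun x : Zt * Gb => log_mgf incl L delta lambda rho x.1 x.2).

(** An infinite positive part would come with a finite negative one, by well-definedness, and give
    integral [+oo] instead of a nonpositive one. The negative part may still be infinite. *)
Lemma variance_posneg rho :
  \int[P \x pihat rho]_x (mgf rho)^\+ x < +oo /\
  \int[P \x pihat rho]_x (mgf rho)^\+ x <= \int[P \x pihat rho]_x (mgf rho)^\- x.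
Proof.
have [/(_ P PPP) [mm semi] /ereal_supP sup0] := vi rho.
have := sup0 _ (ex_intro2 _ _ P PPP erefl).
have /= -> := fubini_semi1 mm semi.
rewrite integralE; move: semi (integral_funepos_ge0 (P \x pihat rho) (mgf rho)).
move: (integral_funeneg_ge0 (P \x pihat rho) (mgf rho)).
move: (\int[_]_x (mgf rho)^\- x) (\int[_]_x (mgf rho)^\+ x).
move=> [a| |] [b| |] // _ [] // _ _; rewrite ?ltry ?leey//.
- by rewrite -?EFinN -?EFinD !lee_fin subr_le0.
- by rewrite -?EFinN -?EFinD !lee_fin subr_le0.
Qed.

Lemma measurable_list_cst {d d'} {T : measurableType d} {U : measurableType d'}
  (l : seq U) : measurable_list (fun _ : T => l).
Proof.
elim/last_ind: l => [|l x IHl]; first exact: measurable_list_nil.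
exact: measurable_list_rcons.
Qed.

Lemma measurable_cumulative_loss_cst l : measurable_fun setT (S l).
Proof.
exact: (measurable_fun_pair2 tt
  (measurable_cumulative_loss mLi md (measurable_list_cst l))).
Qed.

Lemma partition_function_gt0 l : 0 < W l.
Proof.
apply: integral_gt0 => [|g]; last by rewrite lte_fin expR_gt0.
apply/measurable_EFinP; apply: measurableT_comp => //; apply: measurable_funN.
by apply: measurable_funM => //; exact: measurable_cumulative_loss_cst.
Qed.

(** Integrating against the Gibbs law weights [pi] by [e^(- lambda S) / W l]. Merging the exponents
    turns the inner integral of [log_mgf] into [e^(lambda L) W (rcons l x) / W l], whose logarithm
    is the increment. *)
Lemma potential_rcons l x : W l < +oo ->
  N (rcons l x) = N l + mgf (gib l) x.
Proof.
move=> Woo; rewrite /potential /log_mgf.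
have mSl : measurable_fun setT (fun g => lambda * S l g)%R.
  by apply: measurable_funM => //; exact: measurable_cumulative_loss_cst.
rewrite (integral_gibbs mSl Woo)//; last first.
  apply/measurable_EFinP; apply: measurableT_comp => //.
  apply: measurable_funM => //; apply: measurable_funB; first apply: measurable_funB => //.
    exact: (measurable_fun_pair2 x.1 mLi).
  exact: (measurable_fun_pair2 x.1 (measurable_fun_pair1 x.2 md)).
have -> : \int[pi]_g ((expR (lambda * (L x.1 x.2 - L x.1 (incl g) - delta x.1 g x.2)))%:E
    * (expR (- (lambda * S l g)))%:E) = (expR (lambda * L x.1 x.2))%:E * W (rcons l x).
  rewrite -ge0_integralZl//; last first.
    apply/measurable_EFinP; apply: measurableT_comp => //; apply: measurable_funN.
    by apply: measurable_funM => //; exact: measurable_cumulative_loss_cst.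
  apply: eq_integral => g _; rewrite -!EFinM -!expRD cumulative_loss_rcons.
  by congr (expR _)%:E; ring.
have W0 := partition_function_gt0 l; have W'0 := partition_function_gt0 (rcons l x).
have w0 : (0 < fine (W l))%R by rewrite fine_gt0// W0.
have Wfin : W l = (fine (W l))%:E by rewrite fineK// ge0_fin_numE// ltW.
rewrite -/(W l) lneM ?in_itv/= ?leey ?andbT ?lte_fin ?invr_gt0//; last first.
  by rewrite mule_gt0// lte_fin expR_gt0.
rewrite lneM ?in_itv/= ?leey ?andbT ?lte_fin ?expR_gt0//.
rewrite !(leNgt _ 0%R) expR_gt0 invr_gt0 w0/= expRK lnV//.
rewrite big_rcons/= [in lne (W l)]Wfin lne_EFin//.
case: (lne (W (rcons l x))) => [r| |]//.
by rewrite -?EFinN -!EFinD; congr (_%:E); ring.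
Qed.

(** The first inequality is the supermartingale property written without subtraction. The second is
    Jensen's inequality for the negative part, which is convex and nonincreasing; it lets finiteness
    travel backward. *)
Lemma potential_step l (m := P \x pihat (gib l)) :
  \int[m]_x (fun x => N (rcons l x))^\+ x + maxe (- N l) 0 <=
    \int[m]_x (fun x => N (rcons l x))^\- x + maxe (N l) 0 /\
  maxe (- N l) 0 <= \int[m]_x (fun x => N (rcons l x))^\- x.
Proof.
have [Woo|] := ltP (W l) +oo; last first.
  rewrite leye_eq => /eqP Wy; have -> : N l = +oo by rewrite /potential Wy.
  rewrite /= max_r ?leNye// max_l ?leey//; split; last exact: integral_ge0.
  rewrite addey ?leey//; have := integral_funeneg_ge0 m (fun x => N (rcons l x)).
  by case: (\int[_]_x _).
have Nfin : N l \is a fin_num.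
  have W0 := partition_function_gt0 l.
  have Wfin : W l = (fine (W l))%:E by rewrite fineK// ge0_fin_numE// ltW.
  by rewrite /potential Wfin lne_EFin// fine_gt0// W0.
have [ly lle] := variance_posneg (gib l).
have [/(_ P PPP) [mm _] _] := vi (gib l).
have := integral_posneg_addE m (@measurable_cst _ _ _ _ setT (N l)) mm.
have -> : (cst (N l) \+ mgf (gib l)) = fun x => N (rcons l x).
  by apply/funext => x; rewrite /= potential_rcons.
have -> : \int[m]_x (cst (N l))^\- x = maxe (- N l) 0.
  transitivity (\int[m]_x maxe (- N l) 0); last exact: integral_probability_cst.
  by apply: eq_integral => x _; rewrite funenegE.
have -> : \int[m]_x (cst (N l))^\+ x = maxe (N l) 0.
  transitivity (\int[m]_x maxe (N l) 0); last exact: integral_probability_cst.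
  by apply: eq_integral => x _; rewrite funeposE.
have := integral_funeneg_ge0 m (fun x => N (rcons l x)).
have := integral_funepos_ge0 m (fun x => N (rcons l x)).
have := integral_funepos_ge0 m (mgf (gib l)).
move: ly lle; rewrite -/m.
move: (\int[m]_x (fun x => N (rcons l x))^\+ x) (\int[m]_x (fun x => N (rcons l x))^\- x).
move: (\int[m]_x (mgf (gib l))^\+ x) (\int[m]_x (mgf (gib l))^\- x).
move: (N l) Nfin => [a| |]// _.
move=> [u| |] [v| |] [p| |] [q| |] //= _; rewrite -?EFinN -?EFin_max ?lee_fin //=;
  last by rewrite ?addye// ?leey.
- rewrite -!EFinD => uv u0 p0 q0 [e]; split; first by lra.
  have [a0|a0] := leP a 0%R.
    have am : Num.max a 0%R = 0%R by rewrite max_r.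
    by move: e; rewrite am; lra.
  by rewrite max_r//; lra.
- by rewrite ?addye// ?leey.
- by rewrite ?addye// ?leey.
Qed.

End step.

(** * The potential along a run *)

Section supermartingale.
Context {dZ dB dG dO} {Zt : measurableType dZ} {Gb : measurableType dB}
  {G : measurableType dG} {Omega : measurableType dO} {R : realType}.
Variables (incl : G -> Gb) (L : Zt -> Gb -> R) (delta : Zt -> G -> Gb -> R)
  (lambda : R) (pi : probability G R).
Hypotheses (mL : measurable_fun [set: Zt * Gb] (fun x => L x.1 x.2))
  (mLi : measurable_fun [set: Zt * G] (fun x => L x.1 (incl x.2)))
  (md : measurable_fun [set: Zt * G * Gb] (fun x => delta x.1.1 x.1.2 x.2)).
Variables (PP : set (probability Zt R))
  (pihat : probability G R -> probability Gb R)
  (Pr : probability Omega R) (P : probability Zt R) (n : nat)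
  (Z : nat -> Omega -> Zt) (ghat : nat -> Omega -> Gb).
Hypotheses (vi : variance_inequality incl L delta lambda PP pihat) (PPP : PP P).
Hypothesis iidZ : iid Pr P n Z.
Hypothesis draw : forall i, (i <= n)%N ->
  conditional_law Pr (history n Z ghat i) (ghat i)
    (rhohat incl L delta lambda pi pihat (i := i)).

Local Notation S := (cumulative_loss incl L delta).
Local Notation N := (potential incl L delta lambda pi).

Definition run_data i (w : Omega) : seq (Zt * Gb) :=
  zip (sample n Z w) (history n Z ghat i w).2.

Definition fresh_data i (x : Omega * Zt) : seq (Zt * Gb) :=
  rcons (run_data i x.1) (x.2, ghat i x.1).

Lemma measurable_run_data i : (i <= n)%N -> measurable_list (run_data i).
Proof.
move=> lein; apply: (measurable_list_comp (f := history n Z ghat i)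
  (@measurable_list_zip _ _ Zt Gb n i)).
by case: (draw lein).
Qed.

Lemma measurable_fresh_data i : (i <= n)%N -> measurable_list (fresh_data i).
Proof.
move=> lein; apply: measurable_list_rcons.
  exact: (measurable_list_comp (measurable_run_data lein) measurable_fst).
apply/measurable_fun_pair => //; apply: measurableT_comp => //.
by case: (draw lein).
Qed.

Lemma run_data0 w : run_data 0 w = [::].
Proof. by apply: size0nil; rewrite size_zip !size_tuple minn0. Qed.

(** Given the history, the fresh point and [ghat i] are independent with laws [P] and [rhohat]:
    their joint conditional law is the product measure in the variance inequality. Measurability of
    [f] is asked along every [measurable_list], for want of a sigma-algebra on sequences. *)
Lemma integral_fresh_data i (f : seq (Zt * Gb) -> \bar R)
    (F := fun w => \int[P \x rhohat incl L delta lambda pi pihat (i := i)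
       (history n Z ghat i w)]_y f (rcons (run_data i w) y)) :
  (i <= n)%N ->
  (forall d (T : measurableType d) (l : T -> seq (Zt * Gb)), measurable_list l ->
    measurable_fun setT (fun t => f (l t))) ->
  (forall l, 0 <= f l) ->
  measurable_fun setT F /\ \int[Pr \x P]_x f (fresh_data i x) = \int[Pr]_w F w.
Proof.
move=> lein mf f0.
pose phi (x : ((n.-tuple Zt * i.-tuple Gb) * Gb) * Zt) :=
  f (rcons (zip x.1.1.1 x.1.1.2) (x.2, x.1.2)).
have mphi : measurable_fun setT phi.
  apply: mf; apply: measurable_list_rcons.
    apply: (measurable_list_comp (f := fst \o fst)
      (@measurable_list_zip _ _ Zt Gb n i)).
    exact: measurableT_comp.
  by apply/measurable_fun_pair => //; exact: measurableT_comp.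
have mPhi := measurable_fun_fubini_tonelli_F (m2 := P) phi mphi (fun=> f0 _).
have Phi0 x : 0 <= fubini_F P phi x by apply: integral_ge0 => y _; exact: f0.
have FE w : F w = \int[rhohat incl L delta lambda pi pihat (i := i)
    (history n Z ghat i w)]_x fubini_F P phi (history n Z ghat i w, x).
  rewrite /F fubini_tonelli2//; apply: mf.
  by apply: measurable_list_rcons => //; exact: measurable_list_cst.
have [mh _ mrho _] := draw lein.
split.
  rewrite (_ : F = (fun h => \int[rhohat incl L delta lambda pi pihat (i := i) h]_x
      fubini_F P phi (h, x)) \o history n Z ghat i); last exact/funext.
  apply: (measurableT_comp _ mh).
  exact: (measurable_kernel_integral mrho mPhi Phi0).
rewrite fubini_tonelli1//; last exact: (mf _ _ _ (measurable_fresh_data lein)).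
transitivity (\int[Pr]_w (fubini_F P phi (history n Z ghat i w, ghat i w))) => //.
rewrite (integral_conditional_law (draw lein) mPhi)//.
by apply: eq_integral => w _; rewrite FE.
Qed.

Lemma integral_run_dataS i (f : seq (Zt * Gb) -> \bar R) : (i < n)%N ->
  (forall d (T : measurableType d) (l : T -> seq (Zt * Gb)), measurable_list l ->
    measurable_fun setT (fun t => f (l t))) ->
  (forall l, 0 <= f l) ->
  \int[Pr]_w f (run_data i.+1 w) = \int[Pr \x P]_x f (fresh_data i x).
Proof.
move=> ltin mf f0; apply: (integral_fresh iidZ draw) => //.
by apply: mf; exact: measurable_list_zip.
Qed.

Let pos l := maxe (N l) 0.
Let neg l := maxe (- N l) 0.

Let pos0 l : 0 <= pos l. Proof. by rewrite le_max lexx orbT. Qed.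
Let neg0 l : 0 <= neg l. Proof. by rewrite le_max lexx orbT. Qed.

Let mN d (T : measurableType d) (l : T -> seq (Zt * Gb)) :
  measurable_list l -> measurable_fun setT (fun t => N (l t)).
Proof. by move=> ml; apply: measurable_potential. Qed.

Let mpos d (T : measurableType d) (l : T -> seq (Zt * Gb)) :
  measurable_list l -> measurable_fun setT (fun t => pos (l t)).
Proof.
move=> ml; have /measurable_funepos := mN ml.
by congr measurable_fun; apply/funext => t; rewrite funeposE.
Qed.

Let mneg d (T : measurableType d) (l : T -> seq (Zt * Gb)) :
  measurable_list l -> measurable_fun setT (fun t => neg (l t)).
Proof.
move=> ml; have /measurable_funeneg := mN ml.
by congr measurable_fun; apply/funext => t; rewrite funenegE.
Qed.

Lemma integral_potential_step i : (i <= n)%N ->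
  \int[Pr \x P]_x pos (fresh_data i x) + \int[Pr]_w neg (run_data i w) <=
  \int[Pr \x P]_x neg (fresh_data i x) + \int[Pr]_w pos (run_data i w) /\
  \int[Pr]_w neg (run_data i w) <= \int[Pr \x P]_x neg (fresh_data i x).
Proof.
move=> lein.
have [mP ->] := integral_fresh_data lein mpos pos0.
have [mM ->] := integral_fresh_data lein mneg neg0.
pose rho w := rhohat incl L delta lambda pi pihat (i := i) (history n Z ghat i w).
have step w : \int[P \x rho w]_y pos (rcons (run_data i w) y) + neg (run_data i w) <=
    \int[P \x rho w]_y neg (rcons (run_data i w) y) + pos (run_data i w) /\
    neg (run_data i w) <= \int[P \x rho w]_y neg (rcons (run_data i w) y).
  have -> : \int[P \x rho w]_y pos (rcons (run_data i w) y) =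
      \int[P \x rho w]_y (fun y => N (rcons (run_data i w) y))^\+ y.
    by apply: eq_integral => y _; rewrite funeposE.
  have -> : \int[P \x rho w]_y neg (rcons (run_data i w) y) =
      \int[P \x rho w]_y (fun y => N (rcons (run_data i w) y))^\- y.
    by apply: eq_integral => y _; rewrite funenegE.
  exact: (potential_step (incl := incl) (L := L) pi mLi md vi PPP (run_data i w)).
have mdn := mneg (measurable_run_data lein).
have mdp := mpos (measurable_run_data lein).
split.
  rewrite -!ge0_integralD//;  try by move=> w _; apply: integral_ge0.
  apply: ge0_le_integral => //.
  - by move=> w _; apply: adde_ge0 => //; exact: integral_ge0.
  - by apply: emeasurable_funD => //.
  - by apply: emeasurable_funD => //.
  - by move=> w _; exact: (step w).1.
apply: ge0_le_integral => //;
by move=> w _; exact: (step w).2.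
Qed.

(** Two passes over the stages: finiteness of negative parts goes backward from [n], then the
    comparison of positive with negative parts goes forward from 0. The passage between stages uses
    that [run_data i.+1] and [fresh_data i] have the same law. *)
Lemma potential_upper :
  \int[Pr \x P]_x neg (fresh_data n x) < +oo ->
  \int[Pr \x P]_x pos (fresh_data n x) <= \int[Pr \x P]_x neg (fresh_data n x).
Proof.
move=> noo.
have negoo i : (i <= n)%N -> \int[Pr \x P]_x neg (fresh_data i x) < +oo.
  move=> lein; rewrite -(subKn lein); elim: (n - i)%N => [|k IHk]; first by rewrite subn0.
  have [nk|kn] := leqP n k; first by have -> : (n - k.+1 = n - k)%N by lia.
  have e : (n - k = (n - k.+1).+1)%N by lia.
  apply: le_lt_trans IHk; rewrite e.
  by rewrite -integral_run_dataS//; [apply: (integral_potential_step _).2; lia|lia].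
have datan i : (i <= n)%N -> \int[Pr]_w neg (run_data i w) < +oo.
  by move=> lein; exact: le_lt_trans (integral_potential_step lein).2 (negoo i lein).
have up i : (i <= n)%N -> \int[Pr]_w pos (run_data i w) <= \int[Pr]_w neg (run_data i w) ->
    \int[Pr \x P]_x pos (fresh_data i x) <= \int[Pr \x P]_x neg (fresh_data i x).
  move=> lein pn; have [h _] := integral_potential_step lein.
  have nfin : \int[Pr]_w neg (run_data i w) \is a fin_num.
    by rewrite ge0_fin_numE ?datan//; exact: integral_ge0.
  (* The integral of the negative part at stage [i] appears on both sides; its finiteness, the
     outcome of the backward pass, permits cancelling it. *)
  by have := le_trans h (leeD2l _ pn); rewrite leeD2rE.
apply: (up n) => //.
(* Forward pass. On the empty history the partition function is 1, so the potential vanishes. *)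
elim: {-2}n (leqnn n) => [|i IHi] lein.
  under eq_integral do rewrite run_data0.
  under [leRHS]eq_integral do rewrite run_data0.
  have -> : pos [::] = 0.
    rewrite /pos /potential big_nil mulr0 add0e /partition_function.
    under eq_integral do rewrite /cumulative_loss/= mulr0 oppr0 expR0.
    by rewrite integral_probability_cst lne1 maxxx.
  by rewrite integral0 integral_ge0.
rewrite !integral_run_dataS//; apply: up; first exact: ltnW.
by apply: IHi; exact: ltnW.
Qed.

End supermartingale.

(** * The variational bound *)

Section exp_jensen.
Context {d} {T : measurableType d} {R : realType}.
Variables (mu : probability T R) (x : T -> R).
Hypotheses (mx : measurable_fun setT x) (ex1 : \int[mu]_t (expR (x t))%:E <= 1).

Let mE : measurable_fun setT (EFin \o x). Proof. exact/measurable_EFinP. Qed.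
Let me : measurable_fun setT (fun t => (expR (x t))%:E).
Proof. by apply/measurable_EFinP; exact: measurableT_comp. Qed.

Lemma integral_pos_exp : \int[mu]_t (EFin \o x)^\+ t <= 1.
Proof.
apply: le_trans ex1; apply: ge0_le_integral => //.
- exact: measurable_funepos.
- move=> t _; rewrite funeposE /= -EFin_max lee_fin ge_max expR_ge0 andbT.
  by apply: le_trans (expR_ge1Dx _); lra.
Qed.

(** This integrates [x^+ + 1 <= x^- + e^x], the subtraction-free form of [1 + x <= e^x], and then
    cancels the constant 1. *)
Lemma integral_posneg_exp :
  \int[mu]_t (EFin \o x)^\+ t <= \int[mu]_t (EFin \o x)^\- t.
Proof.
have mp : measurable_fun setT (EFin \o x)^\+ by exact: measurable_funepos.
have mn : measurable_fun setT (EFin \o x)^\- by exact: measurable_funeneg.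
have h : \int[mu]_t ((EFin \o x)^\+ t + 1) <=
         \int[mu]_t ((EFin \o x)^\- t + (expR (x t))%:E).
  apply: ge0_le_integral => //.
  - by move=> t _; rewrite adde_ge0.
  - exact: emeasurable_funD.
  - exact: emeasurable_funD.
  - move=> t _; rewrite funeposE funenegE /= -!EFin_max -!EFinD.
    rewrite lee_fin; have := expR_ge1Dx (x t).
    by have [x0|x0] := leP (x t) 0%R; have [y0|y0] := leP (- x t)%R 0%R; lra.
move: h; rewrite !ge0_integralD// integral_probability_cst => h.
have := le_trans h (leeD2l _ ex1).
by rewrite leeD2rE.
Qed.

Lemma integral_le0_exp : \int[mu]_t (x t)%:E <= 0.
Proof.
apply: integral_posneg_le0 integral_posneg_exp.
exact: le_lt_trans integral_pos_exp (ltry _).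
Qed.

End exp_jensen.

(** * Relative entropy and the logarithm of the density *)

Section relative_entropy.
Context {d} {T : measurableType d} {R : realType}.
Variables (rho pi : probability T R).
Hypothesis rhopi : rho `<< pi.

Let f := Radon_Nikodym (charge_of_finite_measure rho) pi.
(** Real-valued so that it can enter exponentials and sums of reals. It can differ from the [lne]
    used in [KL] only where [f t <= 0], a [rho]-null set by [density_gt0]. *)
Definition log_density (t : T) : R := ln (fine (f t)).
Local Notation k := log_density.

Let ffin t : f t \is a fin_num. Proof. exact: Radon_Nikodym_fin_num. Qed.
Let mf : measurable_fun setT f.
Proof. by apply: measurable_int; exact: Radon_Nikodym_integrable. Qed.

Lemma measurable_log_density : measurable_fun setT k.
Proof.
apply: (measurableT_comp (@measurable_ln R)).
by apply: measurableT_comp mf.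
Qed.

Let rhof A : measurable A -> rho A = \int[pi]_(t in A) f t.
Proof. by move=> mA; rewrite -Radon_Nikodym_integral. Qed.

Lemma density_gt0 : {ae rho, forall t, 0 < f t}.
Proof.
pose A := [set t | f t <= 0].
have mA : measurable A.
  by rewrite -[A]setTI; exact: emeasurable_fun_infty_c.
exists A; split => //; last by move=> t /= /negP; rewrite -leNgt.
apply/eqP; rewrite eq_le measure_ge0 andbT rhof//.
rewrite integralE [X in X - _](_ : _ = 0); last first.
  by apply: integral0_eq => t ft; rewrite funeposE max_r.
by rewrite sub0e oppe_le0; apply: integral_ge0.
Qed.

Lemma KLE : KL rho pi = \int[rho]_t (k t)%:E.
Proof.
rewrite /KL asboolT//; apply: ae_eq_integral => //.
- exact: (measurableT_comp (@measurable_lne R) mf).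
- by apply/measurable_EFinP; exact: measurable_log_density.
- apply: filterS density_gt0 => t ft0 _.
  rewrite -/f -[in LHS](fineK (ffin t)) lne_EFin//.
  by rewrite fine_gt0// ft0/= ltey_eq ffin.
Qed.

(** The product [e^(- k) f] is 1 where [f] is positive and at most 0 elsewhere, so the left side
    only collects [u] where [f] is positive. There is no equality in general, since [rho] need not
    dominate [pi]. *)
Lemma integral_exp_log_density (u : T -> \bar R) :
  measurable_fun setT u -> (forall t, 0 <= u t) ->
  \int[rho]_t (u t * (expR (- k t))%:E) <= \int[pi]_t u t.
Proof.
move=> mu u0.
have mk : measurable_fun setT (fun t => (expR (- k t))%:E).
  apply/measurable_EFinP; apply: measurableT_comp => //.
  by apply: measurable_funN; exact: measurable_log_density.
rewrite (integral_density mf rhof)//; first last.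
- by move=> t; rewrite mule_ge0// lee_fin expR_ge0.
- exact: emeasurable_funM.
have mg : measurable_fun setT (fun t => u t * (expR (- k t))%:E * f t).
  by do 2 (apply: emeasurable_funM => //).
(* The chosen version of [f] may be negative at some points, so the comparison goes through the
   positive part of the integrand. *)
rewrite integralE; apply: (@le_trans _ _
  (\int[pi]_t (fun t => u t * (expR (- k t))%:E * f t)^\+ t)).
  by rewrite geeDl// oppe_le0; exact: integral_ge0.
apply: ge0_le_integral => //; first exact: measurable_funepos.
move=> t _; rewrite funeposE ge_max u0 andbT -muleA -[leRHS]mule1 lee_wpmul2l//.
rewrite -(fineK (ffin t)) -EFinM lee_fin /log_density.
have [f0|f0] := leP (fine (f t)) 0%R; last by rewrite expRN lnK ?posrE// mulVf// gt_eqF.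
apply: (@le_trans _ _ 0%R) => //; apply: mulr_ge0_le0 => //; exact: expR_ge0.
Qed.

(** The case [u = 1] above says that [e^(- k)] has [rho]-integral at most 1, and it dominates the
    negative part of [k]. Hence the integral defining [KL] is never of the form [+oo - oo]. *)
Lemma integral_log_density_neg : \int[rho]_t (EFin \o k)^\- t <= 1.
Proof.
have mk := measurable_log_density.
rewrite -funeposN; apply: (@integral_pos_exp _ _ _ rho (\- k)%R).
  exact: measurable_funN.
have := @integral_exp_log_density (cst 1) (measurable_cst _) (fun=> lee01).
rewrite /cst integral_probability_cst; congr (_ <= _).
by apply: eq_integral => t _; rewrite mul1e.
Qed.

End relative_entropy.

Section variational_bound.
Context {d1 d2} {T : measurableType d1} {G : measurableType d2} {R : realType}.
Variables (mu : probability T R) (pi rho : probability G R)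
  (Y : T -> R) (U : T * G -> R).
Hypotheses (mY : measurable_fun setT Y) (mU : measurable_fun setT U)
  (rhopi : rho `<< pi).

Let W t := \int[pi]_g (expR (- U (t, g)))%:E.
Let M t := (Y t)%:E + lne (W t).
Let k := log_density rho pi.

Let mW : measurable_fun setT W.
Proof.
apply: (measurable_fun_fubini_tonelli_F (fun x => (expR (- U x))%:E)) => //.
by apply/measurable_EFinP; apply: measurableT_comp => //; exact: measurable_funN.
Qed.

Let W0 t : 0 < W t.
Proof.
apply: integral_gt0 => [|g]; last by rewrite lte_fin expR_gt0.
apply/measurable_EFinP; apply: measurableT_comp => //; apply: measurable_funN.
exact: measurable_fun_pair2.
Qed.

Let mM : measurable_fun setT M.
Proof.
apply: emeasurable_funD; first exact/measurable_EFinP.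
exact: (measurableT_comp (@measurable_lne R) mW).
Qed.

(* The logarithm of the density, with respect to [rho], of the Gibbs
   distribution of [U (t, .)]; its [rho]-integral is nonpositive. *)
Let x (q : T * G) : R :=
  if W q.1 == +oo then 0%R else (- U q - k q.2 - ln (fine (W q.1)))%R.

Let mk : measurable_fun setT (fun q : T * G => k q.2).
Proof. exact: (measurableT_comp (measurable_log_density rhopi) measurable_snd). Qed.

Let mW1 : measurable_fun setT (fun q : T * G => W q.1).
Proof. exact: (measurableT_comp mW measurable_fst). Qed.

Let mY1 : measurable_fun setT (fun q : T * G => Y q.1).
Proof. exact: (measurableT_comp mY measurable_fst). Qed.

Let mx : measurable_fun setT x.
Proof.
apply: measurable_fun_ifT => //.
  apply: (measurable_fun_bool true); rewrite setTI.
  rewrite (_ : _ @^-1` _ = (fun q : T * G => W q.1) @^-1` [set +oo]).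
    by rewrite -[X in measurable X]setTI; apply: mW1.
  by apply/seteqP; split => q /= /eqP.
apply: measurable_funB; first apply: measurable_funB => //.
  exact: measurable_funN.
apply: (measurableT_comp (@measurable_ln R)).
by apply: measurableT_comp mW1.
Qed.

(** For fixed [t] with [W t] finite, [integral_exp_log_density] bounds the integral of [e^(- U - k)]
    by [W t], which the normalization divides out. Where [W t = +oo] the default [x = 0] gives
    exactly 1. *)
Let int_exp_x : \int[mu \x rho]_q (expR (x q))%:E <= 1.
Proof.
have me : measurable_fun setT (fun q => (expR (x q))%:E).
  by apply/measurable_EFinP; exact: measurableT_comp.
have me1 : measurable_fun setT (fubini_F rho (fun q => (expR (x q))%:E)).
  by apply: measurable_fun_fubini_tonelli_F.
rewrite fubini_tonelli1//.
rewrite -(integral_probability_cst mu 1); apply: ge0_le_integral => //.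
  by move=> t _; apply: integral_ge0.
move=> t _; rewrite /fubini_F /x /=.
have [Wy|Wy] := eqVneq (W t) +oo.
  by under eq_integral do rewrite expR0; rewrite integral_probability_cst.
have Wf : W t = (fine (W t))%:E.
  by rewrite fineK// ge0_fin_numE ?ltey// ltW.
have w0 : (0 < fine (W t))%R by rewrite -lte_fin -Wf.
have mU1 : measurable_fun setT (fun g => (expR (- U (t, g)))%:E).
  apply/measurable_EFinP; apply: measurableT_comp => //; apply: measurable_funN.
  exact: measurable_fun_pair2.
rewrite (eq_integral (fun g => (fine (W t))^-1%:E *
    ((expR (- U (t, g)))%:E * (expR (- k g))%:E))); last first.
  move=> g _; rewrite -!EFinM !expRD [expR (- ln _)]expRN lnK ?posrE//.
  by congr (_%:E); ring.
rewrite ge0_integralZl//; first last.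
- by rewrite lee_fin invr_ge0 ltW.
- apply: emeasurable_funM => //; apply/measurable_EFinP; apply: measurableT_comp => //.
  by apply: measurable_funN; exact: measurable_log_density.
rewrite lee_pdivrMl// mule1 -Wf.
by apply: integral_exp_log_density => // g; rewrite lee_fin expR_ge0.
Qed.

(** By construction of [x], [Y = M + x + U + k] wherever [W] is finite. All four terms on the right
    turn out to have positive parts of finite integral, so the integral splits, and those of [M] and
    [x] are nonpositive. *)
Lemma variational_bound :
  (\int[mu]_t M^\- t < +oo -> \int[mu]_t M^\+ t <= \int[mu]_t M^\- t) ->
  \int[mu \x rho]_q (fun q => (Y q.1)%:E)^\- q < +oo ->
  \int[mu \x rho]_q (EFin \o U)^\+ q < +oo ->
  KL rho pi < +oo ->
  \int[mu \x rho]_q (Y q.1)%:E <= \int[mu \x rho]_q (U q)%:E + KL rho pi.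
Proof.
move=> superM Yoo Uoo KLoo.
have mkG := measurable_log_density rhopi.
have koo : \int[rho]_g (EFin \o k)^\+ g < +oo.
  move: KLoo; rewrite KLE// integralE.
  have := integral_log_density_neg rhopi; have := integral_funeneg_ge0 rho (EFin \o k).
  have := integral_funepos_ge0 rho (EFin \o k).
  change (fun x0 : G => (log_density rho pi x0)%:E) with (EFin \o k).
  by move: (\int[rho]_g (EFin \o k)^\+ g) (\int[rho]_g (EFin \o k)^\- g) =>
    [a| |] [b| |]//= _ _ _ _; exact: ltry.
have lift (f : T -> \bar R) : measurable_fun setT f -> (forall t, 0 <= f t) ->
    \int[mu \x rho]_q f q.1 = \int[mu]_t f t.
  move=> mf f0; rewrite (fubini_tonelli1 (fun q => f q.1))//; last first.
    exact: (measurableT_comp mf measurable_fst).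
  by apply: eq_integral => t _; rewrite /fubini_F /fubini_G /= integral_probability_cst.
have liftG (f : G -> \bar R) : measurable_fun setT f -> (forall t, 0 <= f t) ->
    \int[mu \x rho]_q f q.2 = \int[rho]_t f t.
  move=> mf f0; rewrite (fubini_tonelli2 (fun q => f q.2))//; last first.
    exact: (measurableT_comp mf measurable_snd).
  by apply: eq_integral => t _; rewrite /fubini_F /fubini_G /= integral_probability_cst.
pose fY (q : T * G) := (Y q.1)%:E; pose fM (q : T * G) := M q.1.
pose fx q := (x q)%:E; pose fU q := (U q)%:E; pose fk (q : T * G) := (k q.2)%:E.
have mfY : measurable_fun setT fY by exact/measurable_EFinP.
have mfM : measurable_fun setT fM := measurableT_comp mM measurable_fst.
have mfx : measurable_fun setT fx by exact/measurable_EFinP.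
have mfU : measurable_fun setT fU by exact/measurable_EFinP.
have mfk : measurable_fun setT fk by exact/measurable_EFinP.
have xoo : \int[mu \x rho]_q fx^\+ q < +oo.
  exact: le_lt_trans (integral_pos_exp mx int_exp_x) (ltry _).
have mkp : measurable_fun setT (EFin \o k)^\+.
  by apply: measurable_funepos; exact/measurable_EFinP.
have fkoo : \int[mu \x rho]_q fk^\+ q < +oo.
  rewrite (eq_integral (fun q : T * G => (EFin \o k)^\+ q.2)) ?liftG// => q _.
  by rewrite !funeposE.
have mMp : measurable_fun setT M^\+ by exact: measurable_funepos.
have mMn : measurable_fun setT M^\- by exact: measurable_funeneg.
have liftMp : \int[mu \x rho]_q fM^\+ q = \int[mu]_t M^\+ t.
  rewrite -lift//; apply: eq_integral => q _; by rewrite !funeposE.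
have liftMn : \int[mu \x rho]_q fM^\- q = \int[mu]_t M^\- t.
  rewrite -lift//; apply: eq_integral => q _; by rewrite !funenegE.
(* Solving the decomposition for [M] gives [M^- <= Y^- + x^+ + U^+ + k^+]; where [W] is infinite,
   [M = +oo] and [M^-] vanishes. *)
have Mnoo : \int[mu]_t M^\- t < +oo.
  rewrite -liftMn; apply: (@le_lt_trans _ _ (\int[mu \x rho]_q
    (fY^\- q + (fx^\+ q + (fU^\+ q + fk^\+ q))))).
    have mpos (f : T * G -> \bar R) : measurable_fun setT f -> measurable_fun setT f^\+.
      exact: measurable_funepos.
    have mneg (f : T * G -> \bar R) : measurable_fun setT f -> measurable_fun setT f^\-.
      exact: measurable_funeneg.
    apply: ge0_le_integral => //; first exact: mneg.
    - apply: emeasurable_funD; first exact: mneg.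
      apply: emeasurable_funD; first exact: mpos.
      by apply: emeasurable_funD; exact: mpos.
    - move=> q _; rewrite !funenegE !funeposE /fM /M /fx /x.
      have [Wy|Wy] := eqVneq (W q.1) +oo.
        rewrite Wy /= max_r ?leNye// !adde_ge0// ?le_max ?lexx ?orbT//.
      have Wf : W q.1 = (fine (W q.1))%:E.
        by rewrite fineK// ge0_fin_numE ?ltey// ltW.
      rewrite Wf lne_EFin -?lte_fin -?Wf// /fY /fU /fk.
      rewrite -EFinD -!EFin_max -!EFinD lee_fin.
      move: (ln _) (Y _) (U _) (k _) => a b c e.
      have h (y : R) : (y <= Num.max y 0%R)%R /\ (0 <= Num.max y 0%R)%R.
        by rewrite !le_max !lexx orbT.
      have := h (- b)%R; have := h (- c - e - a)%R; have := h c; have := h e.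
      by rewrite ge_max => *; apply/andP; split; lra.
  have ltyD (f g : T * G -> \bar R) : measurable_fun setT f -> measurable_fun setT g ->
      (forall q, 0 <= f q) -> (forall q, 0 <= g q) ->
      \int[mu \x rho]_q f q < +oo -> \int[mu \x rho]_q g q < +oo ->
      \int[mu \x rho]_q (f q + g q) < +oo.
    by move=> mf mg f0 g0 fy gy; rewrite ge0_integralD// lte_add_pinfty.
  have mxp := measurable_funepos mfx; have mUp := measurable_funepos mfU.
  have mkp' := measurable_funepos mfk; have mYn := measurable_funeneg mfY.
  apply: (ltyD) => //.
  - by apply: emeasurable_funD => //; exact: emeasurable_funD.
  - by move=> q; rewrite !adde_ge0.
  apply: (ltyD) => //.
  - exact: emeasurable_funD.
  - by move=> q; rewrite adde_ge0.
  exact: ltyD.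
have Mpn := superM Mnoo.
have Mpoo := le_lt_trans Mpn Mnoo.
(* The positive part of [M] now has finite integral, so [W] is finite almost everywhere, and there
   the decomposition of [Y] is exact. *)
have YE : {ae mu \x rho, forall q, setT q -> fY q = fM q + (fx q + (fU q + fk q))}.
  have : \int[mu \x rho]_q fM^\+ q < +oo by rewrite liftMp.
  move=> /(ge0_integral_ae_lty (measurable_funepos mfM) (funepos_ge0 fM)).
  apply: filterS => q; rewrite funeposE /fM /M => Mq _.
  have Wf : W q.1 = (fine (W q.1))%:E.
    rewrite fineK// ge0_fin_numE ?ltey; last exact: ltW.
    by apply/eqP => Wy; move: Mq; rewrite Wy /= max_l ?leey.
  have w0 : (0 < fine (W q.1))%R by rewrite -lte_fin -Wf.
  rewrite /fY [in lne _]Wf lne_EFin// /fx /x [X in X == _]Wf /= /fU /fk -!EFinD.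
  congr (_%:E).
  by ring.
have -> : \int[mu \x rho]_q (Y q.1)%:E =
    \int[mu \x rho]_q (fM q + (fx q + (fU q + fk q))).
  apply: ae_eq_integral => //.
  by apply: emeasurable_funD => //; apply: emeasurable_funD => //; exact: emeasurable_funD.
have mUk : measurable_fun setT (fU \+ fk) by exact: emeasurable_funD.
have mxUk : measurable_fun setT (fx \+ (fU \+ fk)) by exact: emeasurable_funD.
have Ukoo : \int[mu \x rho]_q (fU \+ fk)^\+ q < +oo.
  by apply: le_lt_trans (integral_funeposD_le _ mfU mfk) _; exact: lte_add_pinfty.
have xUkoo : \int[mu \x rho]_q (fx \+ (fU \+ fk))^\+ q < +oo.
  by apply: le_lt_trans (integral_funeposD_le _ mfx mUk) _; exact: lte_add_pinfty.
rewrite (@integral_upperD _ _ _ (mu \x rho) fM (fx \+ (fU \+ fk)))//; last first.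
  by rewrite liftMp.
rewrite (@integral_upperD _ _ _ (mu \x rho) fx (fU \+ fk))//.
rewrite (@integral_upperD _ _ _ (mu \x rho) fU fk)//.
have M0 : \int[mu \x rho]_q fM q <= 0.
  by apply: integral_posneg_le0; rewrite ?liftMp ?liftMn.
have x0 : \int[mu \x rho]_q fx q <= 0 by exact: (integral_le0_exp mx int_exp_x).
have kE : \int[mu \x rho]_q fk q = KL rho pi.
  rewrite KLE// (integralE _ _ fk) [RHS]integralE.
  have mkn : measurable_fun setT (EFin \o k)^\-.
    by apply: measurable_funeneg; exact/measurable_EFinP.
  rewrite -(liftG _ mkp)// -(liftG _ mkn)//; congr (_ - _);
    apply: eq_integral => q _; first by rewrite !funeposE.
  by rewrite !funenegE.
rewrite kE -[leRHS]add0e leeD// -[leRHS]add0e leeD//.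
Qed.

End variational_bound.

(** * The output of the algorithm *)

Section uniform_output.
Context {dZ dB dO} {Zt : measurableType dZ} {Gb : measurableType dB}
  {Omega : measurableType dO} {R : realType}.
Variables (Pr : probability Omega R) (n : nat)
  (Z : nat -> Omega -> Zt) (ghat : nat -> Omega -> Gb) (J : Omega -> 'I_n.+1).
Hypotheses (mghat : forall i, (i <= n)%N -> measurable_fun setT (ghat i))
  (mout : measurable_fun setT (output ghat J))
  (unifJ : uniform_index_indep Pr (history n Z ghat n.+1) J).

Lemma output_law B : measurable B ->
  Pr (output ghat J @^-1` B) =
  (n.+1%:R^-1)%:E * \sum_(i < n.+1) Pr (ghat i @^-1` B).
Proof.
move=> mB.
(* The event is cut according to the value of [J]. Indexing by all naturals adds only empty pieces
   beyond [n]. *)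
pose F (i : nat) := [set w | J w = i :> nat] `&` ghat i @^-1` B.
have FE (i : 'I_n.+1) : F i = history n Z ghat n.+1 @^-1` [set h | B (tnth h.2 i)]
    `&` J @^-1` [set i].
  apply/seteqP; split => w.
    by move=> [/= Ji Bw]; split; [rewrite /= tnth_mktuple|exact/val_inj].
  by move=> [/=]; rewrite tnth_mktuple => Bw Ji; split => //=; congr nat_of_ord.
have mT (i : 'I_n.+1) : measurable [set h : n.-tuple Zt * n.+1.-tuple Gb | B (tnth h.2 i)].
  rewrite -[X in measurable X]setTI.
  exact: (measurableT_comp (measurable_tnth i) measurable_snd).
have mF i : measurable (F i).
  have [lein|ltni] := leqP i n.
    apply: measurableI; last first.
      by rewrite -[X in measurable X]setTI; exact: mghat.
    have [+ _] := unifJ (inord i).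
    congr measurable; apply/seteqP; split => w /=.
      by move=> ->; rewrite inordK.
    by move=> Ji; apply/val_inj; rewrite /= Ji inordK.
  rewrite (_ : F i = set0)//; apply/seteqP; split => // w [/= Ji _].
  by move: ltni; rewrite -Ji ltnNge -ltnS ltn_ord.
have tF : trivIset setT F.
  by move=> i j _ _ [w [[/= <- _] [/= <- _]]].
rewrite (_ : _ @^-1` B = \big[setU/set0]_(i < n.+1) F i); last first.
  rewrite -bigcup_mkord; apply/seteqP; split => w.
    by move=> Bw; exists (J w) => //; exact: ltn_ord.
  by move=> [i _ [/= Ji]]; rewrite /output Ji.
transitivity (\sum_(i < n.+1) Pr (F i)); first exact: measure_bigsetU.
rewrite ge0_sume_distrr//; apply: eq_bigr => i _.
rewrite FE; have [_ ->] := unifJ i; last exact: mT.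
by congr (_ * Pr _); apply/seteqP; split => w /=; rewrite tnth_mktuple.
Qed.

Lemma integral_output (f : Gb -> \bar R) :
  measurable_fun setT f -> (forall x, 0 <= f x) ->
  \int[Pr]_w f (output ghat J w) =
  (n.+1%:R^-1)%:E * \sum_(i < n.+1) \int[Pr]_w f (ghat i w).
Proof.
move=> mf f0.
(* Capping the index at [n] gives a measurable map for every natural [i], as the sum of measures
   below requires. *)
have mg i : measurable_fun setT (ghat (minn i n)) by apply: mghat; exact: geq_minr.
pose X i : {mfun Omega >-> Gb} := mfun_Sub (mem_set (mg i)).
have c0 : (0 <= n.+1%:R^-1 :> R)%R by rewrite invr_ge0.
have /= <- := ge0_integral_pushforward mout Pr measurableT mf (fun x _ => f0 x).
pose m : nat -> {measure set Gb -> \bar R} := fun i => distribution Pr (X i).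
transitivity (\int[mscale (NngNum c0) (msum m n.+1)]_y f y).
  apply: eq_measure_integral => B mB _.
  transitivity (Pr (output ghat J @^-1` B)) => //.
  rewrite output_law// /mscale /= /msum /=; congr (_ * _).
  apply: eq_bigr => i _; transitivity (Pr (ghat (minn i n) @^-1` B)) => //.
  by have /minn_idPl -> : (i <= n)%N by rewrite -ltnS.
rewrite ge0_integral_mscale// ge0_integral_measure_sum//=; congr (_ * _).
apply: eq_bigr => i _; rewrite ge0_integral_distribution//=.
by have /minn_idPl -> : (i <= n)%N by rewrite -ltnS.
Qed.

End uniform_output.

Lemma integral_upper_sum {d} {T : measurableType d} {R : realType}
    (mu : {measure set T -> \bar R}) (f : nat -> T -> \bar R) m :
  (forall i, (i < m)%N -> measurable_fun setT (f i)) ->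
  (forall i, (i < m)%N -> \int[mu]_x (f i)^\+ x < +oo) ->
  [/\ measurable_fun setT (fun x => \sum_(i < m) f i x),
    \int[mu]_x (fun x => \sum_(i < m) f i x)^\+ x < +oo &
    \int[mu]_x \sum_(i < m) f i x = \sum_(i < m) \int[mu]_x f i x].
Proof.
elim: m => [|m IHm] mf foo.
  have -> : (fun x => \sum_(i < 0) f i x) = cst 0.
    by apply/funext => x; rewrite big_ord0.
  split; [exact: measurable_cst| |by rewrite integral0 big_ord0].
  rewrite integral0_eq ?ltry// => x _; by rewrite funeposE maxxx.
have [mS Soo SE] := IHm (fun i im => mf i (ltnW im)) (fun i im => foo i (ltnW im)).
have -> : (fun x => \sum_(i < m.+1) f i x) = (fun x => \sum_(i < m) f i x) \+ f m.
  by apply/funext => x; rewrite big_ord_recr.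
split.
- by apply: emeasurable_funD => //; exact: mf.
- apply: le_lt_trans (integral_funeposD_le _ mS (mf m _)) _ => //.
  by apply: lte_add_pinfty => //; exact: foo.
- rewrite big_ord_recr/= -SE; apply: integral_upperD => //; [exact: mf|exact: foo].
Qed.

Lemma sum_upperB {R : realType} (a b : nat -> \bar R) m :
  (forall i, 0 <= a i) -> (forall i, 0 <= b i) -> \sum_(i < m) a i < +oo ->
  \sum_(i < m) (a i - b i) = \sum_(i < m) a i - \sum_(i < m) b i.
Proof.
move=> a0 b0; elim: m => [|m IHm]; first by rewrite !big_ord0 sube0.
rewrite !big_ord_recr/= => aoo.
have A0 : 0 <= \sum_(i < m) a i by apply: sume_ge0.
have B0 : 0 <= \sum_(i < m) b i by apply: sume_ge0.
have Aoo : \sum_(i < m) a i < +oo.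
  by apply: le_lt_trans aoo; rewrite leeDl.
rewrite IHm//; move: (a0 m) (b0 m) aoo A0 B0 Aoo.
move: (\sum_(i < m) a i) (\sum_(i < m) b i) (a m) (b m).
move=> [u| |] [v| |] [x| |] [y| |]//= _ _ _ _ _ _.
by rewrite -?EFinN -?EFinD; congr (_%:E); ring.
Qed.

(** * Sums over the draws as expectations under the output *)

Section sum_over_draws.
Context {dZ dB dG dO} {Zt : measurableType dZ} {Gb : measurableType dB}
  {G : measurableType dG} {Omega : measurableType dO} {R : realType}.
Variables (incl : G -> Gb) (L : Zt -> Gb -> R) (delta : Zt -> G -> Gb -> R)
  (lambda : R) (pi rho : probability G R)
  (pihat : probability G R -> probability Gb R)
  (Pr : probability Omega R) (P : probability Zt R) (n : nat)
  (Z : nat -> Omega -> Zt) (ghat : nat -> Omega -> Gb) (J : Omega -> 'I_n.+1).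
Hypothesis iidZ : iid Pr P n Z.
Hypothesis draw : forall i, (i <= n)%N ->
  conditional_law Pr (history n Z ghat i) (ghat i)
    (rhohat incl L delta lambda pi pihat (i := i)).
Hypotheses (mout : measurable_fun setT (output ghat J))
  (unifJ : uniform_index_indep Pr (history n Z ghat n.+1) J).

Local Notation run_data := (run_data n Z ghat).
Local Notation fresh_data := (fresh_data n Z ghat).
Local Notation Q := ((Pr \x P) \x rho).

Let mghat i : (i <= n)%N -> measurable_fun setT (ghat i).
Proof. by move=> /draw[]. Qed.

Lemma run_data_rcons i w : (i < n)%N -> run_data i.+1 w = rcons (run_data i w) (Z i w, ghat i w).
Proof.
move=> ltin; rewrite /run_data historyS (zip_rcons_nth point) ?size_tuple//.
by rewrite -[X in nth _ _ X]/(val (Ordinal ltin)) -tnth_nth tnth_mktuple.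
Qed.

(** The data point on which draw [i] is tested: the next unseen point while there is one, the fresh
    point for the last draw. *)
Let entry i (x : Omega * Zt) : Zt * Gb :=
  (if (i < n)%N then Z i x.1 else x.2, ghat i x.1).

Lemma sum_fresh_data (f : Zt * Gb -> R) x :
  (\sum_(p <- fresh_data n x) f p = \sum_(i < n.+1) f (entry i x))%R.
Proof.
have run_dataE i : (i <= n)%N ->
    (\sum_(p <- run_data i x.1) f p = \sum_(j < i) f (entry j x))%R.
  elim: i => [|i IHi] lein; first by rewrite run_data0 big_nil big_ord0.
  rewrite (run_data_rcons _ lein) big_rcons big_ord_recr (IHi (ltnW lein)) /=.
  by rewrite /entry /= lein.
by rewrite big_rcons big_ord_recr /= (run_dataE _ (leqnn n)) /entry ltnn.
Qed.

Section nonneg.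
Variable phi : (Zt * Gb) * G -> \bar R.
Hypotheses (mphi : measurable_fun setT phi) (phi0 : forall x, 0 <= phi x).

Let F p := \int[rho]_g phi (p, g).
Let mF : measurable_fun setT F.
Proof. exact: measurable_fun_fubini_tonelli_F. Qed.
Let F0 p : 0 <= F p. Proof. exact: integral_ge0. Qed.

Let integral_Q (u : Omega * Zt -> Zt * Gb) : measurable_fun setT u ->
  \int[Q]_q phi (u q.1, q.2) = \int[Pr \x P]_x F (u x).
Proof.
move=> mu; have mphiu : measurable_fun setT (fun q : Omega * Zt * G => phi (u q.1, q.2)).
  apply: (measurableT_comp mphi (g := fun q : Omega * Zt * G => (u q.1, q.2))).
  apply/measurable_fun_pair; last exact: measurable_snd.
  exact: (measurableT_comp mu measurable_fst).
have gen (mu0 : probability (Omega * Zt)%type R) :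
    \int[mu0 \x rho]_q phi (u q.1, q.2) = \int[mu0]_x F (u x).
  exact: (fubini_tonelli1 _ mphiu (fun=> phi0 _)).
exact: (gen (Pr \x P)).
Qed.

Lemma integral_entry i : (i <= n)%N ->
  \int[Q]_q phi (entry i q.1, q.2) =
  \int[Q]_q phi ((q.1.2, ghat i q.1.1), q.2).
Proof.
rewrite leq_eqVlt => /predU1P[->|ltin].
  by apply: eq_integral => q _; rewrite /entry ltnn.
have mZ : measurable_fun setT (Z i) by case: iidZ => /(_ i ltin).
have mg : measurable_fun setT (ghat i) by exact/mghat/ltnW.
have mE : measurable_fun setT (fun x : Omega * Zt => (Z i x.1, ghat i x.1)).
  by apply/measurable_fun_pair; exact: measurableT_comp.
have mE' : measurable_fun setT (fun x : Omega * Zt => (x.2, ghat i x.1)).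
  by apply/measurable_fun_pair; [exact: measurable_snd|exact: measurableT_comp].
transitivity (\int[Pr \x P]_x F (Z i x.1, ghat i x.1)).
  by rewrite /entry ltin; exact: (integral_Q mE).
transitivity (\int[Pr \x P]_x F (x.2, ghat i x.1)); last first.
  exact/esym/(integral_Q mE').
(* The last entries of [run_data i.+1] and [fresh_data i] are draw [i] paired with [Z i] and with
   the fresh point, so the equality of laws applies to a function of the last entry. *)
pose f (l : seq (Zt * Gb)) := F (last point l).
have mf d (T : measurableType d) (l : T -> seq (Zt * Gb)) :
    measurable_list l -> measurable_fun setT (fun t => f (l t)).
  case=> [|l' u _ mu]; first exact: measurable_cst.
  under eq_fun do rewrite /f last_rcons.
  exact: measurableT_comp mF mu.
transitivity (\int[Pr \x P]_x f (fresh_data i x)); last first.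
  by apply: eq_integral => x _; rewrite /f last_rcons.
rewrite -(integral_run_dataS iidZ draw ltin mf (fun l => F0 _)).
transitivity (\int[Pr]_w F (Z i w, ghat i w)); last first.
  by apply: eq_integral => w _; rewrite (run_data_rcons _ ltin) /f last_rcons.
have gen (g : Omega -> \bar R) : measurable_fun setT g -> (forall w, 0 <= g w) ->
    \int[Pr \x P]_x g x.1 = \int[Pr]_w g w.
  move=> mg' g0; rewrite (fubini_tonelli1 (fun x => g x.1))//.
    by apply: eq_integral => w _; rewrite /fubini_F /= integral_probability_cst.
  exact: (measurableT_comp mg' measurable_fst).
apply: (gen (fun w => F (Z i w, ghat i w))) => //.
by apply: (measurableT_comp mF (g := fun w => (Z i w, ghat i w))); apply/measurable_fun_pair.
Qed.

Lemma integral_output_Q :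
  \int[Q]_q phi ((q.1.2, output ghat J q.1.1), q.2) =
  (n.+1%:R^-1)%:E * \sum_(i < n.+1) \int[Q]_q phi (entry i q.1, q.2).
Proof.
pose F2 g' := \int[P]_z F (z, g').
have mF2 : measurable_fun setT F2 by exact: measurable_fun_fubini_tonelli_G.
have QE (u : Omega -> Gb) : measurable_fun setT u ->
    \int[Q]_q phi ((q.1.2, u q.1.1), q.2) = \int[Pr]_w F2 (u w).
  move=> mu; have mux : measurable_fun setT (fun x : Omega * Zt => (x.2, u x.1)).
    by apply/measurable_fun_pair => //; exact: measurableT_comp.
  transitivity (\int[Pr \x P]_x F (x.2, u x.1)); first exact: (integral_Q mux).
  by rewrite (fubini_tonelli1 (fun x => F (x.2, u x.1)))//; exact: (measurableT_comp mF mux).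
rewrite QE// (integral_output mghat mout unifJ mF2); last by move=> y; exact: integral_ge0.
congr (_ * _); apply: eq_bigr => i _; have lein : (i <= n)%N by rewrite -ltnS.
by rewrite integral_entry// QE//; exact: mghat.
Qed.

End nonneg.

Let mentry i : (i <= n)%N -> measurable_fun setT (entry i).
Proof.
move=> lein; have mg := mghat lein.
apply/measurable_fun_pair; last exact: measurableT_comp.
case: ltnP => [ltin|_]; last exact: measurable_snd.
apply: (measurableT_comp _ measurable_fst).
by case: iidZ => /(_ i ltin).
Qed.

(** The averaging identity is applied to [psi^\+] and [psi^\-], not to the parts of the sum.
    Finiteness on the positive side lets the difference commute with the sum over draws. *)
Lemma integral_sum_fresh (psi : (Zt * Gb) * G -> R) : measurable_fun setT psi ->
  let f q := (psi ((q.1.2, output ghat J q.1.1), q.2))%:E in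
  let g q := (\sum_(p <- fresh_data n q.1) psi (p, q.2))%R%:E in
  \int[Q]_q f^\+ q < +oo ->
  \int[Q]_q g^\+ q < +oo /\ \int[Q]_q g q = n.+1%:R%:E * \int[Q]_q f q.
Proof.
move=> mpsi f g foo.
have mE : measurable_fun setT (EFin \o psi) by exact/measurable_EFinP.
have mp := measurable_funepos mE; have mn := measurable_funeneg mE.
pose h i q := (psi (entry i q.1, q.2))%:E.
pose a i := \int[Q]_q (EFin \o psi)^\+ (entry i q.1, q.2).
pose b i := \int[Q]_q (EFin \o psi)^\- (entry i q.1, q.2).
pose A := \int[Q]_q (EFin \o psi)^\+ ((q.1.2, output ghat J q.1.1), q.2).
pose B := \int[Q]_q (EFin \o psi)^\- ((q.1.2, output ghat J q.1.1), q.2).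
have a0 i : 0 <= a i by exact: integral_ge0.
have b0 i : 0 <= b i by exact: integral_ge0.
have A0 : 0 <= A by exact: integral_ge0.
have sumE (x y : \bar R) : x = (n.+1%:R^-1)%:E * y -> y = n.+1%:R%:E * x.
  by move=> ->; rewrite muleA -EFinM mulfV ?mul1e// pnatr_eq0.
have sa : \sum_(i < n.+1) a i = n.+1%:R%:E * A.
  exact: sumE (integral_output_Q mp (funepos_ge0 _)).
have sb : \sum_(i < n.+1) b i = n.+1%:R%:E * B.
  exact: sumE (integral_output_Q mn (funeneg_ge0 _)).
have Aoo : A < +oo.
  rewrite (_ : A = \int[Q]_q f^\+ q)//.
  by apply: eq_integral => q _; rewrite !funeposE.
have Afin : A \is a fin_num by rewrite ge0_fin_numE.
have aoo : \sum_(i < n.+1) a i < +oo.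
  by rewrite sa -(fineK Afin) -EFinM ltry.
have mh i : (i < n.+1)%N -> measurable_fun setT (h i).
  move=> lein; apply: (measurableT_comp mE (g := fun q : Omega * Zt * G => (entry i q.1, q.2))).
  apply/measurable_fun_pair; last exact: measurable_snd.
  exact: (measurableT_comp (mentry lein) measurable_fst).
have hoo i : (i < n.+1)%N -> \int[Q]_q (h i)^\+ q < +oo.
  move=> lein; rewrite (_ : \int[Q]_q _ = a i).
    apply: le_lt_trans aoo; rewrite (bigD1 (Ordinal lein))//= leeDl//.
    by apply: sume_ge0.
  by apply: eq_integral => q _; rewrite !funeposE.
have [_ Soo SE] := integral_upper_sum mh hoo.
have gE : g = fun q => \sum_(i < n.+1) h i q.
  by apply/funext => q; rewrite /g (sum_fresh_data (fun p => psi (p, q.2))) sumEFin.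
split; first by rewrite gE.
rewrite gE SE (eq_bigr (fun i : 'I_n.+1 => a i - b i)); last first.
  by move=> i _; exact: (integral_compE _ (EFin \o psi) (fun q => (entry i q.1, q.2))).
rewrite sum_upperB// sa sb.
transitivity (n.+1%:R%:E * (A - B)).
  by rewrite (@muleBr _ _ A B)//; exact: fin_num_adde_defr.
congr (_ * _); apply/esym; exact: (integral_compE _ (EFin \o psi)
  (fun q : Omega * Zt * G => ((q.1.2, output ghat J q.1.1), q.2))).
Qed.

End sum_over_draws.

Section integral_scaling.
Context {d} {T : measurableType d} {R : realType}.
Variables (mu : {measure set T -> \bar R}) (f : T -> \bar R).
Hypothesis mf : measurable_fun setT f.

Lemma integral_posZl (c : R) : (0 < c)%R ->
  \int[mu]_x (c%:E * f x) = c%:E * \int[mu]_x f x.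
Proof.
move=> c0; rewrite integralE (integralE _ _ f).
rewrite ge0_funeposM ?ge0_funenegM ?(ltW c0)//.
rewrite !ge0_integralZl//; try exact: measurable_funepos;
  try exact: measurable_funeneg; try by rewrite lee_fin ltW.
have := integral_funepos_ge0 mu f; have := integral_funeneg_ge0 mu f.
move: (\int[mu]_x f^\+ x) (\int[mu]_x f^\- x) => [a| |] [b| |]//= _ _;
  rewrite ?gt0_muley ?gt0_muleNy ?lte_fin//=.
by rewrite -?EFinN -?EFinM -?EFinN -?EFinD -?EFinM; congr (_%:E); ring.
Qed.

(** Since [+oo - oo] evaluates to [-oo], which is not its own opposite, negation passes through the
    integral only when that case is excluded. *)
Lemma integral_lowerN : \int[mu]_x f^\- x < +oo ->
  \int[mu]_x (- f x) = - \int[mu]_x f x.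
Proof.
move=> foo; rewrite integralE (integralE _ _ f).
have -> : (fun x => - f x)^\+ = f^\- by exact: funeposN.
have -> : (fun x => - f x)^\- = f^\+ by exact: funenegN.
have := integral_funepos_ge0 mu f; have := integral_funeneg_ge0 mu f.
move: foo (\int[mu]_x f^\+ x).
move: (\int[mu]_x f^\- x) => [b| |] // _ [a| |] //= _ _.
by rewrite -?EFinN -?EFinD -?EFinN; congr (_%:E); ring.
Qed.

Lemma upper_of_integral_lty :
  \int[mu]_x f^\+ x < +oo \/ \int[mu]_x f^\- x < +oo ->
  \int[mu]_x f x < +oo -> \int[mu]_x f^\+ x < +oo.
Proof.
case=> // foo; rewrite (integralE _ _ f).
move: foo (integral_funepos_ge0 mu f) (integral_funeneg_ge0 mu f).
by move: (\int[mu]_x f^\+ x) (\int[mu]_x f^\- x) => [a| |] [b| |] //= _ _ _ _; exact: ltry.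
Qed.

End integral_scaling.

(** * Iterated expectations as joint integrals *)

Section evaluation.
Context {dZ dB dG dO} {Zt : measurableType dZ} {Gb : measurableType dB}
  {G : measurableType dG} {Omega : measurableType dO} {R : realType}.
Variables (incl : G -> Gb) (L : Zt -> Gb -> R) (delta : Zt -> G -> Gb -> R)
  (rho : probability G R)
  (Pr : probability Omega R) (P : probability Zt R) (n : nat)
  (Z : nat -> Omega -> Zt) (ghat : nat -> Omega -> Gb) (J : Omega -> 'I_n.+1)
  (muhat : n.-tuple Zt -> probability Gb R).
Hypotheses (mL : measurable_fun [set: Zt * Gb] (fun x => L x.1 x.2))
  (mLi : measurable_fun [set: Zt * G] (fun x => L x.1 (incl x.2)))
  (md : measurable_fun [set: Zt * G * Gb] (fun x => delta x.1.1 x.1.2 x.2)).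
Hypothesis clmuhat : conditional_law Pr (sample n Z) (output ghat J) muhat.

Local Notation Q := ((Pr \x P) \x rho).
Local Notation out := (output ghat J).

Let mout : measurable_fun setT out. Proof. by case: clmuhat. Qed.
Let msample : measurable_fun setT (sample n Z). Proof. by case: clmuhat. Qed.
Let mmuhat B : measurable B -> measurable_fun setT (fun w => muhat (sample n Z w) B).
Proof.
by move=> mB; case: clmuhat => _ _ /(_ B mB) mk _; exact: measurableT_comp mk msample.
Qed.

Let integral_muhat (f : Gb -> \bar R) : measurable_fun setT f -> (forall x, 0 <= f x) ->
  \int[Pr]_w \int[muhat (sample n Z w)]_x f x = \int[Pr]_w f (out w).
Proof.
move=> mf f0; have mfs := measurableT_comp mf (@measurable_snd _ _ (n.-tuple Zt) Gb).
exact/esym/(integral_conditional_law clmuhat mfs (fun=> f0 _)).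
Qed.

(** For some [g'] the inner [risk] may be a junk value. Well-definedness of the joint integral makes
    the iterated integral of one part of the loss finite, and [kernel_integral_diff] then disposes
    of those [g']. *)
Lemma expected_riskE : expected_risk_defined L ghat Pr P J ->
  expected_risk L Z Pr P muhat = \int[Pr \x P]_x (L x.2 (out x.1))%:E.
Proof.
move=> [mLo semi].
pose l (x : Zt * Gb) := (L x.1 x.2)%:E.
have ml : measurable_fun setT l by exact/measurable_EFinP.
have mlp := measurable_funepos ml; have mln := measurable_funeneg ml.
pose a (x : Omega * Gb) := \int[P]_z l^\+ (z, x.2).
pose b (x : Omega * Gb) := \int[P]_z l^\- (z, x.2).
have maG : measurable_fun setT (fun g' => \int[P]_z l^\+ (z, g')).
  exact: (measurable_fun_fubini_tonelli_G l^\+ mlp (funepos_ge0 _)).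
have mbG : measurable_fun setT (fun g' => \int[P]_z l^\- (z, g')).
  exact: (measurable_fun_fubini_tonelli_G l^\- mln (funeneg_ge0 _)).
have ma : measurable_fun setT a by exact: (measurableT_comp maG measurable_snd).
have mb : measurable_fun setT b by exact: (measurableT_comp mbG measurable_snd).
have fE x : risk L P x.2 = a x - b x.
  exact: (integral_compE P l (fun z => (z, x.2))).
pose u (x : Omega * Zt) := (x.2, out x.1).
have mu_ : measurable_fun setT u.
  by apply/measurable_fun_pair; [exact: measurable_snd|exact: measurableT_comp].
have pushE (h : Zt * Gb -> \bar R) : measurable_fun setT h -> (forall x, 0 <= h x) ->
    measurable_fun setT (fun g' => \int[P]_z h (z, g')) ->
    \int[Pr]_w \int[muhat (sample n Z w)]_x \int[P]_z h (z, x) =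
    \int[Pr \x P]_x h (u x).
  move=> mh h0 mhG; rewrite integral_muhat//; last by move=> x; exact: integral_ge0.
  have mhu : measurable_fun setT (h \o u) := measurableT_comp mh mu_.
  exact/esym/(fubini_tonelli1 (h \o u) mhu (fun=> h0 _)).
have aE := pushE l^\+ mlp (funepos_ge0 _) maG.
have bE := pushE l^\- mln (funeneg_ge0 _) mbG.
have lu : \int[Pr \x P]_x (L x.2 (out x.1))%:E =
    \int[Pr \x P]_x l^\+ (u x) - \int[Pr \x P]_x l^\- (u x).
  exact: (integral_compE _ l u).
have semi' : \int[Pr \x P]_x l^\+ (u x) < +oo \/ \int[Pr \x P]_x l^\- (u x) < +oo.
  case: semi => s; [left|right]; apply: le_lt_trans s.
    by rewrite le_eqVlt; apply/orP; left; apply/eqP/eq_integral => x _; rewrite !funeposE.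
  by rewrite le_eqVlt; apply/orP; left; apply/eqP/eq_integral => x _; rewrite !funenegE.
have mf : measurable_fun [set: Omega * Gb] (fun x => risk L P x.2).
  under eq_fun do rewrite fE.
  exact: emeasurable_funB.
have a0 x : 0 <= a x by exact: integral_ge0.
have b0 x : 0 <= b x by exact: integral_ge0.
have semi2 : \int[Pr]_w \int[muhat (sample n Z w)]_x a (w, x) < +oo \/
    \int[Pr]_w \int[muhat (sample n Z w)]_x b (w, x) < +oo.
  by rewrite /a /b /= aE bE.
have [_ _] := kernel_integral_diff mmuhat mf ma mb a0 b0 fE semi2.
by rewrite /a /b /= aE bE -lu.
Qed.

Lemma expected_DeltaE :
  well_defined_integral Q (fun x => (delta x.1.2 x.2 (out x.1.1))%:E) ->
  expected_Delta delta Z Pr P muhat rho =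
  \int[Q]_q (delta q.1.2 q.2 (out q.1.1))%:E.
Proof.
move=> [mdo semi].
pose l (x : Zt * G * Gb) := (delta x.1.1 x.1.2 x.2)%:E.
have ml : measurable_fun setT l by exact/measurable_EFinP.
have mlp := measurable_funepos ml; have mln := measurable_funeneg ml.
pose a (x : (G * Omega) * Gb) := \int[P]_z l^\+ (z, x.1.1, x.2).
pose b (x : (G * Omega) * Gb) := \int[P]_z l^\- (z, x.1.1, x.2).
have mfib (h : Zt * G * Gb -> \bar R) : measurable_fun setT h -> (forall x, 0 <= h x) ->
    measurable_fun setT (fun x : (G * Omega) * Gb => \int[P]_z h (z, x.1.1, x.2)).
  move=> mh h0; apply: (measurable_fun_fubini_tonelli_G
    (fun y : Zt * ((G * Omega) * Gb) => h (y.1, y.2.1.1, y.2.2))) => //.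
  apply: (measurableT_comp mh
    (g := fun y : Zt * ((G * Omega) * Gb) => (y.1, y.2.1.1, y.2.2))).
  have m21 : measurable_fun [set: Zt * ((G * Omega) * Gb)] (fun y => y.2.1).
    exact: (measurableT_comp measurable_fst measurable_snd).
  apply/measurable_fun_pair; last exact: (measurableT_comp measurable_snd measurable_snd).
  apply/measurable_fun_pair; first exact: measurable_fst.
  exact: (measurableT_comp measurable_fst m21).
have ma : measurable_fun setT a by exact: mfib.
have mb : measurable_fun setT b by exact: mfib.
have fE (x : (G * Omega) * Gb) : Delta delta P x.1.1 x.2 = a x - b x.
  exact: (integral_compE P l (fun z => (z, x.1.1, x.2))).
have a0 x : 0 <= a x by exact: integral_ge0.
have b0 x : 0 <= b x by exact: integral_ge0.
have mf : measurable_fun [set: (G * Omega) * Gb] (fun x => Delta delta P x.1.1 x.2).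
  rewrite (_ : (fun x => _) = (fun x => a x - b x)); last exact/funext.
  exact: emeasurable_funB.
(* Taking [G * Omega] as the base space reduces the integrals over [rho], [Pr] and [muhat] to a
   single kernel integral over [rho \x Pr]. *)
pose kap (x : G * Omega) := muhat (sample n Z x.2).
have mkap B : measurable B -> measurable_fun setT (fun x => kap x B).
  by move=> mB; exact: (measurableT_comp (mmuhat mB) measurable_snd).
pose u (q : Omega * Zt * G) := (q.1.2, q.2, out q.1.1).
have mu_ : measurable_fun setT u.
  have m11 : measurable_fun [set: Omega * Zt * G] (fun q => q.1.1).
    exact: (measurableT_comp measurable_fst measurable_fst).
  apply/measurable_fun_pair; last exact: (measurableT_comp mout m11).
  apply/measurable_fun_pair; last exact: measurable_snd.
  exact: (measurableT_comp measurable_snd measurable_fst).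
have pushE (h : Zt * G * Gb -> \bar R) : measurable_fun setT h -> (forall x, 0 <= h x) ->
    \int[rho \x Pr]_t \int[kap t]_x \int[P]_z h (z, t.1, x) = \int[Q]_q h (u q).
  move=> mh h0.
  have mK := measurable_kernel_integral mkap (mfib h mh h0)
    (fun=> integral_ge0 _ (fun _ _ => h0 _)).
  rewrite fubini_tonelli1//; last first.
    by move=> t; apply: integral_ge0 => x _; exact: integral_ge0.
  have mhu : measurable_fun setT (h \o u) := measurableT_comp mh mu_.
  have gen (m0 : probability (Omega * Zt)%type R) :
      \int[rho]_g \int[m0]_x h (u (x, g)) = \int[m0 \x rho]_q h (u q).
    exact/esym/(fubini_tonelli2 (h \o u) mhu (fun=> h0 _)).
  rewrite -(gen (Pr \x P)); apply: eq_integral => g _; rewrite /fubini_F /kap /=.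
  (* The [point] fills the coordinate in [Omega], on which the integral does not depend. *)
  have mhg : measurable_fun setT (fun x => \int[P]_z h (z, g, x)).
    exact: (measurableT_comp (mfib h mh h0)
      (g := fun x : Gb => ((g, point), x)) (measurable_fun_pair _ _)).
  rewrite integral_muhat//; last by move=> x; exact: integral_ge0.
  have mhug : measurable_fun setT (fun x => h (u (x, g))).
    exact: (measurable_fun_pair1 g mhu).
  exact/esym/(fubini_tonelli1 _ mhug (fun=> h0 _)).
have aE := pushE l^\+ mlp (funepos_ge0 _).
have bE := pushE l^\- mln (funeneg_ge0 _).
have semi2 : \int[rho \x Pr]_t \int[kap t]_x a (t, x) < +oo \/
    \int[rho \x Pr]_t \int[kap t]_x b (t, x) < +oo.
  rewrite /a /b /= aE bE; case: semi => s; [left|right]; apply: le_lt_trans s.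
    by rewrite le_eqVlt; apply/orP; left; apply/eqP/eq_integral => x _; rewrite !funeposE.
  by rewrite le_eqVlt; apply/orP; left; apply/eqP/eq_integral => x _; rewrite !funenegE.
have [mK sK KE] := kernel_integral_diff mkap mf ma mb a0 b0 fE semi2.
(* Separating [rho] from [Pr] again is Fubini for an integrand that is itself an integral; [sK]
   provides the finite part. *)
transitivity (\int[rho \x Pr]_t \int[kap t]_x Delta delta P t.1 x).
  by rewrite -fubini_semi1.
rewrite KE /a /b /= aE bE; apply/esym.
exact: (integral_compE _ l u).
Qed.

End evaluation.

Section marginals.
Context {d1 d2} {T1 : measurableType d1} {T2 : measurableType d2} {R : realType}.
Variables (m1 : probability T1 R) (m2 : probability T2 R).

Lemma integral_fst (f : T1 -> \bar R) : measurable_fun setT f ->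
  \int[m1 \x m2]_q f q.1 = \int[m1]_x f x.
Proof.
have ge0 (g : T1 -> \bar R) : measurable_fun setT g -> (forall x, 0 <= g x) ->
    \int[m1 \x m2]_q g q.1 = \int[m1]_x g x.
  move=> mg g0; have mg1 := measurableT_comp mg (@measurable_fst _ _ T1 T2).
  rewrite (fubini_tonelli1 _ mg1 (fun=> g0 _)).
  by apply: eq_integral => x _; rewrite /fubini_F /= integral_probability_cst.
move=> mf; rewrite (integral_compE _ f fst) (integralE _ _ f).
by rewrite !ge0//; [exact: measurable_funeneg|exact: measurable_funepos].
Qed.

Lemma integral_snd (f : T2 -> \bar R) : measurable_fun setT f ->
  \int[m1 \x m2]_q f q.2 = \int[m2]_x f x.
Proof.
have ge0 (g : T2 -> \bar R) : measurable_fun setT g -> (forall x, 0 <= g x) ->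
    \int[m1 \x m2]_q g q.2 = \int[m2]_x g x.
  move=> mg g0; have mg1 := measurableT_comp mg (@measurable_snd _ _ T1 T2).
  rewrite (fubini_tonelli2 _ mg1 (fun=> g0 _)).
  by apply: eq_integral => x _; rewrite /fubini_G /= integral_probability_cst.
move=> mf; rewrite (integral_compE _ f snd) (integralE _ _ f).
by rewrite !ge0//; [exact: measurable_funeneg|exact: measurable_funepos].
Qed.

End marginals.

(** * The regret bound *)

Section regret.
Context {dZ dB dG dO} {Zt : measurableType dZ} {Gb : measurableType dB}
  {G : measurableType dG} {Omega : measurableType dO} {R : realType}.
Variables (incl : G -> Gb) (L : Zt -> Gb -> R) (delta : Zt -> G -> Gb -> R)
  (lambda : R) (pi rho : probability G R) (PP : set (probability Zt R))
  (pihat : probability G R -> probability Gb R)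
  (Pr : probability Omega R) (P : probability Zt R) (n : nat)
  (Z : nat -> Omega -> Zt) (ghat : nat -> Omega -> Gb) (J : Omega -> 'I_n.+1)
  (muhat : n.-tuple Zt -> probability Gb R).
Hypotheses (mL : measurable_fun [set: Zt * Gb] (fun x => L x.1 x.2))
  (mLi : measurable_fun [set: Zt * G] (fun x => L x.1 (incl x.2)))
  (md : measurable_fun [set: Zt * G * Gb] (fun x => delta x.1.1 x.1.2 x.2)).
Hypotheses (lambda0 : (0 < lambda)%R)
  (vi : variance_inequality incl L delta lambda PP pihat) (PPP : PP P)
  (iidZ : iid Pr P n Z)
  (sr : SeqRand incl L delta Z ghat lambda pi pihat Pr J muhat).

Local Notation Q := ((Pr \x P) \x rho).
Local Notation out := (output ghat J).

Let integral_Q_PG (f : Zt * G -> \bar R) :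
  measurable_fun setT f -> (forall x, 0 <= f x) ->
  \int[Q]_q f (q.1.2, q.2) = \int[P \x rho]_x f x.
Proof.
move=> mf f0.
have mu_ : measurable_fun [set: Omega * Zt * G] (fun q => (q.1.2, q.2)).
  apply/measurable_fun_pair; last exact: measurable_snd.
  exact: (measurableT_comp measurable_snd measurable_fst).
have mfu := measurableT_comp mf mu_.
have gen (m0 : probability (Omega * Zt)%type R) :
    \int[m0 \x rho]_q f (q.1.2, q.2) = \int[rho]_g \int[m0]_x f (x.2, g).
  exact: (fubini_tonelli2 _ mfu (fun=> f0 _)).
transitivity (\int[rho]_g \int[(Pr \x P)]_x f (x.2, g)); first exact: (gen (Pr \x P)).
rewrite (fubini_tonelli2 _ mf f0); apply: eq_integral => g _.
exact: (integral_snd Pr P (measurable_fun_pair1 g mf)).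
Qed.

Lemma cumulative_lossE l g : cumulative_loss incl L delta l g =
  (\sum_(p <- l) (L p.1 (incl g) + delta p.1 g p.2))%R.
Proof.
elim/last_ind: l => [|l p IHl]; first by rewrite big_nil.
by rewrite cumulative_loss_rcons big_rcons IHl /= addrA.
Qed.

Lemma regret_bound : expected_risk_defined L ghat Pr P J ->
  oracle_bound_defined incl L delta Z ghat Pr P muhat lambda J pi rho ->
  expected_risk L Z Pr P muhat <=
    oracle_bound incl L delta Z Pr P muhat lambda pi rho.
Proof.
case: (sr) => draw unifJ clmuhat erd [wB wC defBC defBCK].
have mout : measurable_fun setT out by case: clmuhat.
set A := expected_risk _ _ _ _ _.
move: defBC defBCK; rewrite /oracle_bound.
set B := \int[rho]_g risk L P (incl g); set C := expected_Delta _ _ _ _ _ _.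
set K := KL rho pi => defBC defBCK.
pose N : R := (lambda * n.+1%:R)%R.
have N0 : (0 < N)%R by rewrite mulr_gt0// ltr0n.
pose fA (q : Omega * Zt * G) := (L q.1.2 (out q.1.1))%:E.
pose fB (q : Omega * Zt * G) := (L q.1.2 (incl q.2))%:E.
pose fC (q : Omega * Zt * G) := (delta q.1.2 q.2 (out q.1.1))%:E.
have mfA : measurable_fun setT fA.
  by case: erd => m _; exact: (measurableT_comp m measurable_fst).
have mfB : measurable_fun setT fB.
  apply/measurable_EFinP; apply: (measurableT_comp mLi
    (g := fun q : Omega * Zt * G => (q.1.2, q.2))).
  apply/measurable_fun_pair; last exact: measurable_snd.
  exact: (measurableT_comp measurable_snd measurable_fst).
have mfC : measurable_fun setT fC by case: wC.
have AE : A = \int[Q]_q fA q.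
  rewrite /A (expected_riskE mL clmuhat erd).
  by case: erd => m _; exact/esym/(integral_fst (Pr \x P) rho m).
have CE : C = \int[Q]_q fC q by exact: (expected_DeltaE md clmuhat wC).
have semiA : \int[Q]_q fA^\+ q < +oo \/ \int[Q]_q fA^\- q < +oo.
  case: erd => m; set h := (fun x => _) in m * => s.
  have -> : \int[Q]_q fA^\+ q = \int[Pr \x P]_x h^\+ x.
    rewrite -(integral_fst (Pr \x P) rho (measurable_funepos m)).
    by apply: eq_integral => q _; rewrite !funeposE.
  have -> : \int[Q]_q fA^\- q = \int[Pr \x P]_x h^\- x.
    rewrite -(integral_fst (Pr \x P) rho (measurable_funeneg m)).
    by apply: eq_integral => q _; rewrite !funenegE.
  exact: s.
have semiC : \int[Q]_q fC^\+ q < +oo \/ \int[Q]_q fC^\- q < +oo by case: wC.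
have [BE semiB] : B = \int[Q]_q fB q /\
    (\int[Q]_q fB^\+ q < +oo \/ \int[Q]_q fB^\- q < +oo).
  case: wB => m; set h := (fun x => _) in m * => s.
  have hp : \int[Q]_q fB^\+ q = \int[P \x rho]_x h^\+ x.
    rewrite -(integral_Q_PG (measurable_funepos m))//.
    by apply: eq_integral => q _; rewrite !funeposE.
  have hn : \int[Q]_q fB^\- q = \int[P \x rho]_x h^\- x.
    rewrite -(integral_Q_PG (measurable_funeneg m))//.
    by apply: eq_integral => q _; rewrite !funenegE.
  rewrite (integralE _ _ fB) hp hn; split => //.
  by rewrite /B -(integralE _ _ h) -(fubini_semi2 m s).
(* If the entropy or [B + C] is [+oo], so is the whole bound, because the sums are assumed not to be
   of the form [+oo - oo]. *)
have [Koo|] := ltP K +oo; last first.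
  rewrite leye_eq => /eqP Ky; move: defBCK; rewrite Ky gt0_mulye ?lte_fin ?invr_gt0//.
  by case: (B + C) => [r| |]//= _; rewrite ?leey.
have [BCoo|] := ltP (B + C) +oo; last first.
  rewrite leye_eq => /eqP BCy; move: defBCK; rewrite BCy.
  by case: (K * _) => [r| |]//= _; rewrite ?leey.
have [Boo Coo] : B < +oo /\ C < +oo.
  by move: BCoo defBC; move: (B) (C) => [b| |] [c| |]//= _ _; split; rewrite ?ltry.
(* An infinite negative part forces [A = -oo]. In the remaining case [fA^\-], [fB^\+] and [fC^\+]
   all have finite integral, as [variational_bound] needs. *)
have [fAn|] := ltP (\int[Q]_q fA^\- q) +oo; last first.
  rewrite leye_eq => /eqP fAn.
  suff -> : A = -oo by rewrite leNye.
  case: semiA => [fAp|]; last by rewrite fAn.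
  rewrite AE integralE fAn; move: fAp (integral_funepos_ge0 Q fA).
  by case: (\int[_]_q fA^\+ q).
have fBoo : \int[Q]_q fB^\+ q < +oo by apply: upper_of_integral_lty; rewrite -?BE.
have fCoo : \int[Q]_q fC^\+ q < +oo by apply: upper_of_integral_lty; rewrite -?CE.
pose Y (x : Omega * Zt) := (lambda * \sum_(p <- fresh_data n Z ghat n x) L p.1 p.2)%R.
pose U (q : Omega * Zt * G) :=
  (lambda * cumulative_loss incl L delta (fresh_data n Z ghat n q.1) q.2)%R.
have mlist : measurable_list (fresh_data n Z ghat n) := measurable_fresh_data draw (leqnn n).
have mY : measurable_fun setT Y.
  by apply: measurable_funM => //; exact: measurable_sum_loss.
have mU : measurable_fun setT U.
  by apply: measurable_funM => //; exact: (measurable_cumulative_loss mLi md mlist).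
(* The sign is reversed because [fAn] controls the negative part of the loss, whereas
   [integral_sum_fresh] asks for a finite positive part. *)
pose psiY (x : Zt * Gb * G) := (- L x.1.1 x.1.2)%R.
have mpsiY : measurable_fun setT psiY.
  by apply: measurable_funN; exact: (measurableT_comp mL measurable_fst).
pose psiU (x : Zt * Gb * G) := (L x.1.1 (incl x.2) + delta x.1.1 x.2 x.1.2)%R.
have mpsiU : measurable_fun setT psiU.
  have m11 : measurable_fun [set: Zt * Gb * G] (fun x => x.1.1).
    exact: (measurableT_comp measurable_fst measurable_fst).
  have m12 : measurable_fun [set: Zt * Gb * G] (fun x => x.1.2).
    exact: (measurableT_comp measurable_snd measurable_fst).
  apply: measurable_funD.
    apply: (measurableT_comp mLi (g := fun x : Zt * Gb * G => (x.1.1, x.2))).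
    by apply/measurable_fun_pair.
  apply: (measurableT_comp md (g := fun x : Zt * Gb * G => (x.1.1, x.2, x.1.2))).
  by apply/measurable_fun_pair => //; apply/measurable_fun_pair.
have [|gYoo gYE] := @integral_sum_fresh _ _ _ _ _ _ _ _ _ incl L delta lambda pi rho
    pihat Pr P n Z ghat J iidZ draw mout unifJ psiY mpsiY.
  move: fAn; congr (_ < _); apply: eq_integral => q _.
  by rewrite funeposE funenegE.
have [|gUoo gUE] := @integral_sum_fresh _ _ _ _ _ _ _ _ _ incl L delta lambda pi rho
    pihat Pr P n Z ghat J iidZ draw mout unifJ psiU mpsiU.
  apply: le_lt_trans (lte_add_pinfty fBoo fCoo).
  exact: (integral_funeposD_le _ mfB mfC).
pose gY q := (\sum_(p <- fresh_data n Z ghat n q.1) psiY (p, q.2))%R%:E : \bar R.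
pose gU q := (\sum_(p <- fresh_data n Z ghat n q.1) psiU (p, q.2))%R%:E : \bar R.
have YgY (q : Omega * Zt * G) : (Y q.1)%:E = lambda%:E * - gY q.
  rewrite /gY -EFinN -EFinM -sumrN; congr (_ * _)%:E.
  by apply: eq_bigr => p _; rewrite opprK.
have UgU q : (U q)%:E = lambda%:E * gU q.
  by rewrite /U cumulative_lossE -EFinM.
have l0 : lambda != 0%R by rewrite gt_eqF.
have mgU : measurable_fun setT gU.
  rewrite (_ : gU = fun q => (lambda^-1 * U q)%:E).
    by apply/measurable_EFinP; exact: measurable_funM.
  by apply/funext => q; rewrite /U cumulative_lossE mulrA mulVf// mul1r.
have mNgY : measurable_fun setT (\- gY).
  rewrite (_ : \- gY = fun q => (lambda^-1 * Y q.1)%:E).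
    apply/measurable_EFinP; apply: measurable_funM => //.
    exact: (measurableT_comp mY measurable_fst).
  by apply/funext => q; rewrite EFinM YgY muleA -!EFinM mulVf// mul1r.
have NgYoo : \int[Q]_q (\- gY)^\- q < +oo by rewrite funenegN.
have intY : \int[Q]_q (Y q.1)%:E = N%:E * A.
  have e1 : \int[Q]_q gY q = - \int[Q]_q (- gY q).
    transitivity (\int[Q]_q - - gY q); last exact: integral_lowerN NgYoo.
    by apply: eq_integral => q _; rewrite oppeK.
  have e2 : \int[Q]_q gY q = n.+1%:R%:E * - A.
    by rewrite AE -(integral_lowerN fAn).
  have e3 : \int[Q]_q (- gY q) = n.+1%:R%:E * A.
    by rewrite -[LHS]oppeK -e1 e2 muleN oppeK.
  transitivity (\int[Q]_q (lambda%:E * (\- gY) q)).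
    by apply: eq_integral => q _; rewrite YgY.
  by rewrite (integral_posZl _ mNgY)// e3 muleA -EFinM.
have intU : \int[Q]_q (U q)%:E = N%:E * (B + C).
  under eq_integral do rewrite UgU.
  rewrite (integral_posZl _ mgU)// [\int[Q]_q gU q]gUE muleA -EFinM BE CE.
  by rewrite -(integral_upperD mfB mfC).
have rhopi : rho `<< pi.
  by apply: contrapT => nrhopi; move: Koo; rewrite /K /KL asboolF// ltxx.
have VB : \int[Q]_q (Y q.1)%:E <= \int[Q]_q (U q)%:E + K.
  apply: (@variational_bound _ _ _ _ _ (Pr \x P) pi rho Y U mY mU rhopi) => //.
  - pose M t := (Y t)%:E + lne (\int[pi]_g (expR (- U (t, g)))%:E).
    change (\int[Pr \x P]_t M^\- t < +oo ->
      \int[Pr \x P]_t M^\+ t <= \int[Pr \x P]_t M^\- t) => Moo.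
    have Mp : \int[Pr \x P]_t M^\+ t = \int[Pr \x P]_t
        maxe (potential incl L delta lambda pi (fresh_data n Z ghat n t)) 0.
      by apply: eq_integral => t _; exact: funeposE.
    have Mn : \int[Pr \x P]_t M^\- t = \int[Pr \x P]_t
        maxe (- potential incl L delta lambda pi (fresh_data n Z ghat n t)) 0.
      by apply: eq_integral => t _; exact: funenegE.
    rewrite Mp Mn; rewrite Mn in Moo.
    exact: (potential_upper mL mLi md vi PPP iidZ draw).
  - rewrite (_ : \int[_]_q _ = lambda%:E * \int[Q]_q gY^\+ q).
      by apply: lte_mul_pinfty => //; rewrite lee_fin ltW.
    rewrite -ge0_integralZl ?lee_fin ?(ltW lambda0)//.
      apply: eq_integral => q _; rewrite funenegE YgY funeposE.
      by rewrite maxe_pMr ?lee_fin ?(ltW lambda0)// mule0 muleN oppeK.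
    by rewrite -funenegN; exact: measurable_funeneg.
  - rewrite (_ : \int[_]_q _ = lambda%:E * \int[Q]_q gU^\+ q).
      by apply: lte_mul_pinfty => //; rewrite lee_fin ltW.
    rewrite -ge0_integralZl ?lee_fin ?(ltW lambda0)//.
      apply: eq_integral => q _; rewrite funeposE /= UgU funeposE.
      by rewrite maxe_pMr ?lee_fin ?(ltW lambda0)// mule0.
    exact: measurable_funepos.
(* What remains is [N A <= N (B + C) + K] with [N = lambda (n + 1)], to be divided by [N]; the
   infinite values are checked case by case. *)
move: VB BCoo Koo; rewrite intY intU -/N.
have N1 : (0 < N^-1)%R by rewrite invr_gt0.
move: (A) (B + C) (K) => [a| |] [b| |] [k| |] //=; rewrite ?leNye ?leey//
  ?gt0_muley ?gt0_muleNy ?gt0_mulNye ?lte_fin//=.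
  rewrite -!EFinM -!EFinD !lee_fin => h _ _.
  by rewrite -(ler_pM2l N0) mulrDr [(N * (k / N))%R]mulrC divfK ?gt_eqF.
Qed.

End regret.

(** * Entropy of a Dirac mass with respect to the uniform distribution *)

Section dirac_entropy.
Context {d} {G : measurableType d} {R : realType}.
Variable pi : probability G R.
Hypothesis unif : uniform_distribution pi.

Local Notation card A := (#|` fset_set A|).

Let fin (A : set G) : finite_set A.
Proof. by case: unif => fG _; exact: sub_finite_set fG. Qed.

Let card_gt0 (A : set G) g : A g -> (0 < card A)%N.
Proof.
move=> Ag; rewrite cardfs_gt0; apply/fset0Pn; exists g.
by rewrite in_fset_set ?inE.
Qed.

Let piE A : measurable A -> pi A = ((card A)%:R / (card [set: G])%:R)%:E.
Proof. by case: unif => _; exact. Qed.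

Lemma dirac_dominates_uniform g : \d_g `<< pi.
Proof.
apply/null_content_dominatesP => A mA pA0; have : pi A = 0 by [].
rewrite piE// diracE => /eqP; rewrite eqe mulf_eq0 invr_eq0 !pnatr_eq0 => A0.
case: (boolP (g \in A)) => //; rewrite inE => Ag; move: A0.
have cA := card_gt0 Ag; have cG : (0 < card [set: G])%N by exact: (@card_gt0 _ g).
by rewrite (gtn_eqF cA) (gtn_eqF cG).
Qed.

(** Singletons need not be measurable in [G], so the entropy is [ln] of the cardinality of [G]
    divided by that of a measurable set containing [g]. This is why a bound is stated instead of an
    equality. *)
Lemma KL_dirac_uniform g :
  exists2 r, KL (\d_g : probability G R) pi = r%:E &
    (r <= ln (card [set: G])%:R)%R.
Proof.
have dom := dirac_dominates_uniform g.
pose f := Radon_Nikodym (charge_of_finite_measure (\d_g : probability G R)) pi.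
have ffin t : f t \is a fin_num by exact: Radon_Nikodym_fin_num.
have mf : measurable_fun setT f.
  by apply: measurable_int; exact: Radon_Nikodym_integrable.
have fg0 : 0 < f g.
  have [N [mN N0 fN]] := density_gt0 dom.
  rewrite ltNge; apply/negP => fg; move: N0.
  rewrite /= diracE mem_set ?oner_eq0//; first by move=> /eqP; rewrite onee_eq0.
  by apply: fN => /=; apply/negP; rewrite -leNgt.
(* On this level set of the density [f] is constant and the Dirac mass at [g] gives it mass 1,
   whence [f g = 1 / pi A]. *)
pose A := f @^-1` [set f g].
have mA : measurable A.
  by rewrite -[A]setTI; apply: mf => //; exact: emeasurable_set1.
have Ag : A g by [].
have fA : f g * pi A = 1.
  have <- : (\d_g : set G -> \bar R) A = 1 by rewrite diracE mem_set.
  have -> : (\d_g : set G -> \bar R) A = \int[pi]_(t in A) f t.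
    by rewrite -Radon_Nikodym_integral.
  rewrite (eq_integral (cst (f g))) ?integral_cst//.
  by move=> t; rewrite inE.
exists (ln (fine (f g))).
  rewrite KLE// integral_dirac ?diracT ?mul1e//.
  by apply/measurable_EFinP; exact: measurable_log_density.
have cA := card_gt0 Ag; have cG : (0 < card [set: G])%N by exact: (@card_gt0 _ g).
have y0 : (0 < fine (f g))%R by rewrite -lte_fin fineK.
move: fA; rewrite piE// -[f g](fineK (ffin g)) -EFinM => -[fA].
rewrite ler_ln ?posrE ?ltr0n// (_ : (card [set: G])%:R = fine (f g) * (card A)%:R)%R.
  by apply: ler_peMr; [exact: ltW|rewrite ler1n].
have G0 : (0 < (card [set: G])%:R :> R)%R by rewrite ltr0n.
rewrite -[LHS]mul1r -{1}fA.
by rewrite -!mulrA mulVf ?mulr1 ?gt_eqF.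
Qed.

End dirac_entropy.

Theorem theorem3p1 (R : realType)
    (dX dY dG dO : measure_display)
    (X : measurableType dX) (Y : measurableType dY)
    (F : set (set {mfun X >-> Y}))
    (G : measurableType dG) (incl : G -> predictor F)
    (L : X * Y -> predictor F -> R)
    (lambda : R) (pi : probability G R)
    (PP : set (probability (X * Y)%type R))
    (delta : X * Y -> G -> predictor F -> R)
    (pihat : probability G R -> probability (predictor F) R)
    (P : probability (X * Y)%type R)
    (Omega : measurableType dO) (Pr : probability Omega R)
    (n : nat) (Z : nat -> Omega -> X * Y)
    (ghat : nat -> Omega -> predictor F) (J : Omega -> 'I_n.+1)
    (muhat : n.-tuple (X * Y)%type -> probability (predictor F) R) :
  injective incl ->
  measurable_fun [set: X * Y * predictor F] (fun x => L x.1 x.2) ->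
  measurable_fun [set: X * Y * G] (fun x => L x.1 (incl x.2)) ->
  measurable_fun [set: X * Y * G * predictor F]
    (fun x => delta x.1.1 x.1.2 x.2) ->
  (0 < lambda)%R ->
  variance_inequality incl L delta lambda PP pihat ->
  PP P ->
  iid Pr P n Z ->
  SeqRand incl L delta Z ghat lambda pi pihat Pr J muhat ->
  expected_risk_defined L ghat Pr P J ->
  expected_risk L Z Pr P muhat <=
    ereal_inf [set oracle_bound incl L delta Z Pr P muhat lambda pi rho
              | rho in [set rho | oracle_bound_defined incl L delta Z ghat
                                    Pr P muhat lambda J pi rho]]
  /\
  (finite_set [set: G] ->
   (forall z g g', delta z g g' = 0%R) ->
   uniform_distribution pi ->
   (forall g, well_defined_integral P (fun z => (L z (incl g))%:E)) ->
   expected_risk L Z Pr P muhat <=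
     ereal_inf [set risk L P (incl g) | g in [set: G]]
     + (ln (#|` fset_set [set: G]|)%:R / (lambda * n.+1%:R))%:E).
Proof.
move=> _ mL mLi md lambda0 vi PPP iidZ sr erd.
have main rho : oracle_bound_defined incl L delta Z ghat Pr P muhat lambda J pi rho ->
    expected_risk L Z Pr P muhat <= oracle_bound incl L delta Z Pr P muhat lambda pi rho.
  move=> obd; exact: (regret_bound mL mLi md lambda0 vi PPP iidZ sr erd obd).
split; first by apply: le_ereal_inf_tmp => _ [rho obd <-]; exact: main.
move=> finG delta0 unif wr.
set c := (ln _ / _)%R.
(* The real constant is moved across so that the infimum can be treated one [g] at a time. *)
rewrite -leeBlDr//; apply: le_ereal_inf_tmp => _ [g _ <-]; rewrite leeBlDr//.
have [r KLr rc] := KL_dirac_uniform unif g.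
pose rho : probability G R := \d_g.
pose l (x : X * Y * G) := (L x.1 (incl x.2))%:E.
have ml : measurable_fun setT l by exact/measurable_EFinP.
have mlp := measurable_funepos ml; have mln := measurable_funeneg ml.
have mG (h : X * Y * G -> \bar R) : measurable_fun setT h -> (forall x, 0 <= h x) ->
    measurable_fun setT (fun g' => \int[P]_z h (z, g')).
  by move=> mh h0; exact: (measurable_fun_fubini_tonelli_G h mh h0).
have mrisk : measurable_fun setT (fun g' => risk L P (incl g')).
  rewrite (_ : (fun _ => _) = fun g' =>
      \int[P]_z l^\+ (z, g') - \int[P]_z l^\- (z, g')).
    by apply: emeasurable_funB; exact: mG.
  by apply/funext => g'; exact: (integral_compE P l (pair^~ g')).
have at_g (h : X * Y * G -> \bar R) : measurable_fun setT h -> (forall x, 0 <= h x) ->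
    \int[P \x rho]_x h x = \int[P]_z h (z, g).
  move=> mh h0; rewrite (fubini_tonelli2 _ mh h0).
  transitivity (\int[\d_g]_g' \int[P]_z h (z, g')) => //.
  by rewrite integral_dirac ?diracT ?mul1e//; exact: mG.
have BE : \int[rho]_g' risk L P (incl g') = risk L P (incl g).
  by rewrite integral_dirac// diracT mul1e.
have CE : expected_Delta delta Z Pr P muhat rho = 0.
  apply: integral0_eq => g' _; apply: integral0_eq => w _.
  by apply: integral0_eq => x _; apply: integral0_eq => z _; rewrite delta0.
have KE : KL rho pi * ((lambda * n.+1%:R)^-1)%:E = (r / (lambda * n.+1%:R))%:E.
  by rewrite KLr -EFinM.
(* For the Dirac mass at [g] the joint integral of the loss reduces to the one assumed well defined.
   The [Delta] and entropy terms are finite, so no [+oo - oo] arises even if the risk is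
   infinite. *)
have : oracle_bound_defined incl L delta Z ghat Pr P muhat lambda J pi rho.
  split.
  - split => //; rewrite !at_g//; case: (wr g) => _ [s|s]; [left|right];
      move: s; congr (_ < _); apply: eq_integral => z _.
      by rewrite !funeposE.
    by rewrite !funenegE.
  - rewrite (_ : (fun x => _) = cst 0).
      split; [exact: measurable_cst|left].
      by rewrite integral0_eq ?ltry// => x _; rewrite funeposE maxxx.
    by apply/funext => x; rewrite delta0.
  - by rewrite CE; exact: fin_num_adde_defl.
  - by rewrite KE; exact: fin_num_adde_defl.
move=> /main; rewrite /oracle_bound BE CE KE adde0 => /le_trans; apply.
rewrite leeD2l// lee_fin /c ler_pM2r// invr_gt0 mulr_gt0// ltr0n//.
Qed.
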